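(* Let $R$ be a complete local domain of prime characteristic $p>0$. Then the generalized colon-capturing property holds for tight closure: if $x_1,\ldots,x_{k+1}$ is a partial system of parameters for $R$, $J=(x_1,\ldots,x_k)$, $M$ is a finitely generated $R$-module, $f:M\to R/J$ is a surjective $R$-module homomorphism, and $v\in M$ satisfies $f(v)=x_{k+1}+J$, then $$(Rv)^*_M\cap\ker f\subseteq (Jv)^*_M.$$
   Context: Local rings are Noetherian. A partial system of parameters is a sequence that forms part of a system of parameters of $R$. For $e\ge 0$, $\mathbf F^e$ denotes the $e$-th iterated Frobenius (Peskine-Szpiro) functor, i.e., base change $R\otimes_R -$ along the $e$-th iterate $r\mapsto r^{p^e}$ of the Frobenius endomorphism of $R$. For finitely generated $R$-modules $N\subseteq M$, the tight closure $N^*_M$ is the set of $u\in M$ for which there exists $c\in R$, not in any minimal prime of $R$ (for $R$ a domain: $c\ne 0$), such that for all $e\gg 0$ the element $c\otimes u\in\mathbf F^e(M)$ lies in $\operatorname{Im}(\mathbf F^e(N)\to\mathbf F^e(M))$. *)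

(* Defs.v *)
From HB Require Import structures.
From mathcomp Require Import all_boot all_order all_algebra.
From mathcomp Require Import generic_quotient ring_quotient.
From mathcomp Require Import boolp classical_sets.
From mathcomp Require Import freeg.

Set Implicit Arguments.
Unset Strict Implicit.
Unset Printing Implicit Defensive.

Import GRing.Theory.
Local Open Scope ring_scope.
Local Open Scope quotient_scope.
Local Open Scope classical_set_scope.

(* A submodule of M is an element of the library type [submodClosed M], and an
   ideal of R is a submodule of the regular module R^o.  The unit ideal is
   allowed; properness is stated separately where it is needed.  Membership is
   boolean: the classical [`[< _ >]] turns any proposition into a boolean. *)
Notation ideal R := (submodClosed R^o).

Section Submodules.
Variables (R : nzRingType) (M : lmodType R).

Definition span (A : set M) : {pred M} :=
  fun x => `[< forall N : submodClosed M,
                 (forall y, A y -> y \in N) -> x \in N >].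

Lemma span_subsemimod_closed A : GRing.subsemimod_closed (span A).
Proof.
split; [split=> [|x y /asboolP xA /asboolP yA]|move=> a x /asboolP xA];
  apply/asboolP => N AN.
- exact: rpred0.
- by apply: rpredD; [apply: xA | apply: yA].
- by apply: rpredZ; apply: xA.
Qed.

HB.instance Definition _ A :=
  GRing.isSubmodClosed.Build R M (span A) (span_subsemimod_closed A).

Lemma mem_span (A : set M) x : A x -> x \in span A.
Proof. by move=> Ax; apply/asboolP => N; apply. Qed.

Lemma span_min (A : set M) (N : submodClosed M) :
  (forall y, A y -> y \in N) -> {subset span A <= N}.
Proof. by move=> AN x /asboolP; apply. Qed.

Definition finitely_generated : Prop :=
  exists s : seq M, forall x : M, x \in span [set` s].

Definition ideal_mul (I : ideal R) (N : submodClosed M) : submodClosed M :=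
  span [set w | exists a, exists u, [/\ a \in I, u \in N & w = a *: u]].

Definition cyclic_submod (v : M) : submodClosed M := span [set v].

Definition submod_type (N : submodClosed M) : Type := {x : M | x \in N}.

End Submodules.

Section SubmoduleModule.
Variables (R : nzRingType) (M : lmodType R) (N : submodClosed M).

HB.instance Definition _ := SubChoice.on (submod_type N).
HB.instance Definition _ := [SubChoice_isSubLmodule of submod_type N by <:].

Definition submod_incl : {linear submod_type N -> M} := val.

End SubmoduleModule.

(* The library structure [submodClosed] has no opposite in it, as it also covers
   semimodules, while the library quotient asks for a subgroup.  Over a ring the
   opposite is the multiplication by -1. *)
Definition submod_zmod (R : nzRingType) (M : lmodType R) (N : submodClosed M) :
    zmodClosed M :=
  HB.pack (GRing.SubmodClosed.sort N)
    (GRing.isZmodClosed.Build M (GRing.SubmodClosed.sort N)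
       (GRing.submod_closedB (submodClosedP N))).

Definition modquot (R : nzRingType) (M : lmodType R) (N : submodClosed M) :
  Type := Quotient.quot (submod_zmod N).

Section ModuleQuotient.
Variables (R : nzRingType) (M : lmodType R) (N : submodClosed M).

HB.instance Definition _ := GRing.Zmodule.on (modquot N).

Local Notation quotN := (Quotient.quot (submod_zmod N)).

Definition modpi (x : M) : modquot N := \pi_quotN x.

Lemma modpi_eq x y : (modpi x = modpi y) <-> (x - y \in N).
Proof.
have xyE : (x - y \in N) = (modpi x == modpi y) :=
  Quotient.idealrBE (submod_zmod N) x y.
by rewrite xyE; split=> /eqP.
Qed.

Lemma modpiB x y : modpi (x - y) = modpi x - modpi y.
Proof. exact: (raddfB \pi_quotN). Qed.

Lemma modpi_repr (x : modquot N) : modpi (repr (x : quotN)) = x.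
Proof. exact: reprK. Qed.

Definition modquot_scale (a : R) (x : modquot N) : modquot N :=
  modpi (a *: repr (x : quotN)).

Lemma modquot_scale_pi a x : modquot_scale a (modpi x) = modpi (a *: x).
Proof.
by apply/modpi_eq; rewrite -scalerBr; apply: rpredZ; apply/modpi_eq/modpi_repr.
Qed.

Lemma modpiD x y : modpi (x + y) = modpi x + modpi y.
Proof. exact: (raddfD \pi_quotN). Qed.

Fact modquot_scaleA a b x :
  modquot_scale a (modquot_scale b x) = modquot_scale (a * b) x.
Proof. by rewrite -[x]modpi_repr !modquot_scale_pi scalerA. Qed.

Fact modquot_scale1 : left_id 1 modquot_scale.
Proof. by move=> x; rewrite -[x]modpi_repr modquot_scale_pi scale1r. Qed.

Fact modquot_scaleDr : right_distributive modquot_scale +%R.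
Proof.
move=> a x y; rewrite -[x]modpi_repr -[y]modpi_repr -modpiD !modquot_scale_pi.
by rewrite scalerDr modpiD.
Qed.

Fact modquot_scaleDl x : {morph modquot_scale^~ x : a b / a + b}.
Proof.
by move=> a b; rewrite -[x]modpi_repr !modquot_scale_pi scalerDl modpiD.
Qed.

HB.instance Definition _ := GRing.Zmodule_isLmodule.Build R (modquot N)
  modquot_scaleA modquot_scale1 modquot_scaleDr modquot_scaleDl.

Fact modpi_is_linear : linear modpi.
Proof. by move=> a x y; rewrite modpiD -modquot_scale_pi. Qed.

HB.instance Definition _ :=
  GRing.isLinear.Build R M (modquot N) _ modpi modpi_is_linear.

End ModuleQuotient.

(* Base change along phi : R -> S.  The S-module [S (x)_R M] is presented as the
   free S-module on the set M modulo the relations saying that u |-> 1 (x) u is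
   phi-semilinear, and r (x) u is the class of r[u]; [base_change_universal]
   below checks the defining universal property. *)
Section BaseChange.
Variables (R S : comNzRingType) (phi : {rmorphism R -> S}).

Section Object.
Variable M : lmodType R.

Definition base_change_rel : set {freeg M / S} :=
  [set w | (exists u, exists v, w = << u + v >> - << u >> - << v >>)
        \/ (exists a, exists u, w = << a *: u >> - << phi a *g u >>)].

Definition base_change : lmodType S :=
  modquot (span base_change_rel : submodClosed _).

Definition tens (r : S) (u : M) : base_change :=
  modpi (span base_change_rel : submodClosed _) << r *g u >>.

Lemma freegU_scale (r : S) (u : M) : << r *g u >> = r *: << u >>.
Proof. by apply/eqP/freeg_eqP => x; rewrite coeffZ !coeffU mul1r. Qed.

Lemma tensE r u : tens r u = r *: tens 1 u.
Proof. by rewrite /tens freegU_scale linearZ. Qed.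

Lemma tens1D u v : tens 1 (u + v) = tens 1 u + tens 1 v.
Proof.
rewrite /tens -linearD; apply/modpi_eq/mem_span; left.
by exists u, v; rewrite opprD addrA.
Qed.

Lemma tens1Z a u : tens 1 (a *: u) = phi a *: tens 1 u.
Proof. by rewrite -tensE; apply/modpi_eq/mem_span; right; exists a, u. Qed.

Lemma base_change_ind (P : base_change -> Prop) :
  P 0 -> (forall r u z, P z -> P (tens r u + z)) -> forall z, P z.
Proof.
move=> P0 PD z; rewrite -[z]modpi_repr -[repr _]freeg_sumE.
elim: (dom _) => [|u s IHs]; first by rewrite big_nil linear0.
by rewrite big_cons linearD; apply: PD.
Qed.

End Object.

Section Lift.
Variables (M : lmodType R) (Q : lmodType S) (g : M -> Q).
Fact fglift_is_linear : linear (fglift g : {freeg M / S} -> Q).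
Proof.
have gB := @lift_is_additive S M Q g.
pose gA := GRing.isZmodMorphism.Build _ _ (fglift g) gB.
pose h : {additive {freeg M / S} -> Q} := HB.pack (fglift g) gA.
have hD x y : fglift g (x + y) = fglift g x + fglift g y := raddfD h x y.
have hS (s : seq M) (F : M -> {freeg M / S}) :
  fglift g (\sum_(u <- s) F u) = \sum_(u <- s) fglift g (F u).
  exact: (raddf_sum h).
move=> a x y; rewrite hD; congr (_ + _).
rewrite -[x]freeg_sumE scaler_sumr !hS scaler_sumr.
apply: eq_bigr => u _; rewrite freegU_scale scalerA -!freegU_scale.
by rewrite !liftU scalerA.
Qed.

HB.instance Definition _ :=
  GRing.isLinear.Build S {freeg M / S} Q _ (fglift g) fglift_is_linear.

Definition base_change_lift (z : base_change M) : Q :=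
  fglift g (repr (z : Quotient.quot (submod_zmod (span (@base_change_rel M))))).

Definition semilinear_along : Prop :=
  (forall u v, g (u + v) = g u + g v) /\ (forall a u, g (a *: u) = phi a *: g u).

Hypothesis g_semilin : semilinear_along.

Lemma base_change_lift_pi w :
  base_change_lift (modpi (span (@base_change_rel M)) w) = fglift g w.
Proof.
pose K : {pred {freeg M / S}} := fun w => fglift g w == 0.
have K_closed : GRing.subsemimod_closed K.
  split; [split=> [|x y]|move=> a x]; rewrite -?topredE /= /K ?linear0 //.
    by move=> /eqP x0 /eqP y0; rewrite linearD /= x0 y0 addr0.
  by move=> /eqP x0; rewrite linearZ /= x0 scaler0.
pose KS : submodClosed _ :=
  HB.pack K (GRing.isSubmodClosed.Build S {freeg M / S} K K_closed).
apply/eqP; rewrite -subr_eq0 -linearB /=.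
have /modpi_eq := modpi_repr (modpi (span (@base_change_rel M)) w).
apply: (span_min (N := KS)) => y [[u [v ->]]|[a [u ->]]]; apply/eqP.
  by rewrite !linearB /= !liftU !scale1r g_semilin.1 addrAC addrK subrr.
by rewrite linearB /= !liftU scale1r g_semilin.2 subrr.
Qed.

Fact base_change_lift_is_linear : linear base_change_lift.
Proof.
move=> a x y; rewrite -[x]modpi_repr -[y]modpi_repr -linearP.
by rewrite !base_change_lift_pi linearP.
Qed.

Lemma base_change_lift_tens r u : base_change_lift (tens r u) = r *: g u.
Proof. by rewrite base_change_lift_pi liftU. Qed.

Lemma base_change_universal :
  exists h : {linear base_change M -> Q},
    (forall u, h (tens 1 u) = g u) /\
    (forall h' : {linear base_change M -> Q},
       (forall u, h' (tens 1 u) = g u) -> h' =1 h).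
Proof.
pose hL := GRing.isLinear.Build S (base_change M) Q _ base_change_lift
  base_change_lift_is_linear.
pose h : {linear base_change M -> Q} := HB.pack base_change_lift hL.
exists h; split=> [u|h' h'E]; first by rewrite /= base_change_lift_tens scale1r.
apply: base_change_ind => [|r u z h'z]; first by rewrite !linear0.
by rewrite !linearD h'z tensE !linearZ /= h'E base_change_lift_tens scale1r.
Qed.

End Lift.

Section Map.
Variables (M N : lmodType R) (g : {linear M -> N}).

Fact tens_comp_semilinear : semilinear_along (fun u => tens 1 (g u)).
Proof.
by split=> [u v|a u]; rewrite ?linearD ?linearZ /= ?tens1D ?tens1Z.
Qed.

Definition base_change_map : base_change M -> base_change N :=
  base_change_lift (fun u => tens 1 (g u)).

HB.instance Definition _ :=
  GRing.isLinear.Build S (base_change M) (base_change N) _ base_change_map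
    (base_change_lift_is_linear tens_comp_semilinear).

Lemma base_change_map_tens r u : base_change_map (tens r u) = tens r (g u).
Proof.
rewrite [RHS]tensE.
exact: base_change_lift_tens tens_comp_semilinear r u.
Qed.

End Map.
End BaseChange.

Section LocalRings.
Variable R : comNzRingType.
Implicit Types (I P Q m : ideal R) (x : seq R).

Definition ideal_gen (x : seq R) : ideal R := span ([set` x] : set R^o).

Definition ideal_pow I (n : nat) : ideal R :=
  iter n (ideal_mul I) (span (setT : set R^o)).

Definition noetherian : Prop :=
  forall I, exists x : seq R, I =i ideal_gen x.

Definition maximal_ideal m : Prop :=
  1 \notin m /\
  forall I, {subset m <= I} -> 1 \notin I -> {subset I <= m}.

Definition prime_ideal P : Prop :=
  1 \notin P /\ forall a b : R, a * b \in P -> (a \in P) || (b \in P).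

Definition minimal_prime P : Prop :=
  prime_ideal P /\ forall Q, prime_ideal Q -> {subset Q <= P} -> {subset P <= Q}.

(* Local rings are Noetherian by convention. *)
Definition local_ring m : Prop :=
  [/\ noetherian, maximal_ideal m & forall n, maximal_ideal n -> n =i m].

Definition adic_cauchy I (a : nat -> R) : Prop :=
  forall n, exists N, forall i j,
    (N <= i)%N -> (N <= j)%N -> a i - a j \in ideal_pow I n.

Definition adic_limit I (a : nat -> R) (l : R) : Prop :=
  forall n, exists N, forall i, (N <= i)%N -> a i - l \in ideal_pow I n.

(* Uniqueness of limits makes completeness include separatedness. *)
Definition adic_complete I : Prop :=
  forall a, adic_cauchy I a -> exists! l, adic_limit I a l.

Definition prime_chain (n : nat) (C : nat -> ideal R) : Prop :=
  (forall i, (i <= n)%N -> prime_ideal (C i)) /\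
  (forall i, (i < n)%N ->
     {subset C i <= C i.+1} /\ ~ {subset C i.+1 <= C i}).

Definition has_krull_dim (d : nat) : Prop :=
  (exists C, prime_chain d C) /\
  (forall n C, prime_chain n C -> (n <= d)%N).

(* dim R elements generating an m-primary ideal; the second condition says that m
   is the radical of (x), so in particular that x is contained in m. *)
Definition system_of_parameters m x : Prop :=
  has_krull_dim (size x) /\
  (forall a : R, a \in m <-> exists n, a ^+ n \in ideal_gen x).

Definition partial_system_of_parameters m x : Prop :=
  exists y : seq R, system_of_parameters m (x ++ y).

End LocalRings.

Section TightClosure.
Variables (p : nat) (R : comNzRingType) (charRp : p \in [pchar R]).

Section Frobenius.
Variable e : nat.

Definition iter_frobenius : R -> R := iter e (pFrobenius_aut charRp).

Lemma iter_frobeniusE r : iter_frobenius r = r ^+ (p ^ e).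
Proof.
rewrite /iter_frobenius; elim: e => [|n /= ->]; first by rewrite expr1.
by rewrite pFrobenius_autE -exprM -expnSr.
Qed.

Fact iter_frobenius_is_zmod_morphism : zmod_morphism iter_frobenius.
Proof.
by rewrite /iter_frobenius; elim: e => // n IHn x y; rewrite !iterS IHn rmorphB.
Qed.

Fact iter_frobenius_is_monoid_morphism : monoid_morphism iter_frobenius.
Proof.
by rewrite /iter_frobenius; elim: e => // n [IH1 IHM];
   split=> [|x y]; rewrite !iterS ?IH1 ?rmorph1 // IHM rmorphM.
Qed.

HB.instance Definition _ :=
  GRing.isZmodMorphism.Build R R iter_frobenius iter_frobenius_is_zmod_morphism.
HB.instance Definition _ :=
  GRing.isMonoidMorphism.Build R R iter_frobenius
    iter_frobenius_is_monoid_morphism.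

Definition frobenius_functor (M : lmodType R) : lmodType R :=
  base_change iter_frobenius M.

Definition frobenius_functor_map (M N : lmodType R) (g : {linear M -> N}) :
    {linear frobenius_functor M -> frobenius_functor N} :=
  base_change_map g.

End Frobenius.

Definition tight_closure (M : lmodType R) (N : submodClosed M) : set M :=
  [set u | exists2 c : R,
     (forall P : ideal R, minimal_prime P -> c \notin P) &
     exists e0, forall e, (e0 <= e)%N ->
       exists z : frobenius_functor e (submod_type N),
         frobenius_functor_map e (submod_incl N) z
           = tens (iter_frobenius e) c u].

End TightClosure.

(* Main.v *)
From HB Require Import structures.
Require Import Defs.
From mathcomp Require Import all_boot all_order all_algebra.
From mathcomp Require Import generic_quotient ring_quotient.
From mathcomp Require Import boolp classical_sets.
From mathcomp Require Import ring.

Set Implicit Arguments.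
Unset Strict Implicit.
Unset Printing Implicit Defensive.

Import GRing.Theory.
Local Open Scope ring_scope.
Local Open Scope classical_set_scope.

(** Applying f to an equation c u^q = r v^q in F^e(M) gives
    r x_{k+1}^q in (x_1^q, ..., x_k^q), so it suffices to find one c <> 0 that
    multiplies (x_1^n, ..., x_k^n) : x_{k+1}^n into (x_1^n, ..., x_k^n) for
    all n.  Let x_1, ..., x_d be a full system of parameters.  R contains a
    coefficient field K, and is finite over the subring A of the values at the
    x_i of power series over K; hence c R lies in a free A-submodule of R for
    some nonzero c in A.  The x_i are analytically independent, so they behave
    like variables in A, where the colon property is trivial.

    Analytic independence and the finiteness of dimension rest on one fact: a
    nonzero power series in y_1, ..., y_r becomes a unit times a power of one
    variable modulo r - 1 elements z, so modulo its value all the y_i are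
    nilpotent modulo z.  As a nonzero prime meets A outside 0, induction shows
    that a domain finite over the values of power series in y_1, ..., y_r has no
    chain of primes of length greater than r.

    K is the intersection of subrings S_n that lift the residue field modulo
    m^n.  S_(n+1) is a maximal subring of S_n that meets m in m^(n+1) and
    contains all p-th powers of S_n. *)

(** * Ideals and the residue field *)

(** Submodules are boolean predicates; this packs a closed Prop-valued set as one, classically. *)
Lemma submod_of (R : nzRingType) (M : lmodType R) (A : set M) :
  A 0 -> (forall x y, A x -> A y -> A (x + y)) ->
  (forall a x, A x -> A (a *: x)) ->
  exists N : submodClosed M, forall x, (x \in N) = `[< A x >].
Proof.
move=> A0 AD AZ; pose S : {pred M} := fun x => `[< A x >].
have S_closed : GRing.subsemimod_closed S.
  split; [split=> [|x y]|move=> a x]; rewrite -!topredE /= /S.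
  - exact/asboolP.
  - by move=> /asboolP Ax /asboolP Ay; apply/asboolP/AD.
  - by move=> /asboolP Ax; apply/asboolP/AZ.
pose N : submodClosed M := HB.pack S (GRing.isSubmodClosed.Build R M S
  S_closed).
by exists N.
Qed.

Section Ideals.
Variable R : comNzRingType.
Implicit Types (I : ideal R) (a b : R).

Lemma ideal_mull I a b : b \in I -> a * b \in I.
Proof. exact: rpredZ. Qed.

Lemma ideal_mulr I a b : b \in I -> b * a \in I.
Proof. by rewrite mulrC; exact: ideal_mull. Qed.

Lemma ideal_add I a b : a \in I -> b \in I -> a + b \in I.
Proof. exact: rpredD. Qed.

Lemma ideal_opp I a : a \in I -> - a \in I.
Proof. by move=> aI; rewrite -mulN1r; exact: ideal_mull. Qed.

Lemma ideal_sub I a b : a \in I -> b \in I -> a - b \in I.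
Proof. by move=> aI bI; apply: ideal_add => //; exact: ideal_opp. Qed.

Lemma ideal_0 I : 0 \in I.
Proof. exact: rpred0. Qed.

Lemma ideal_exp I a n : a \in I -> (0 < n)%N -> a ^+ n \in I.
Proof. by case: n => // n aI _; rewrite exprS; exact: ideal_mulr. Qed.

(** The ideal m + aR contains m strictly, so by maximality it contains 1. *)
Lemma maximal_ideal_inv (m : ideal R) a :
  maximal_ideal m -> a \notin m -> exists b, 1 - a * b \in m.
Proof.
move=> [m1 maxm] am.
have [|||I IE] := @submod_of _ R^o [set r | exists2 b, b \in m & exists s, r = b
  + a * s].
- by exists 0; [exact: ideal_0 | exists 0; rewrite mulr0 addr0].
- move=> _ _ [b bm [s ->]] [c cm [t ->]]; exists (b + c);
  first exact: ideal_add.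
  by exists (s + t); ring.
- move=> r _ [b bm [s ->]]; exists (r * b); first exact: ideal_mull.
  by exists (r * s); rewrite -[LHS]/(r * (b + a * s)); ring.
case: (boolP (1 \in I)) => [|I1].
  rewrite IE => /asboolP [b bm [s E]]; exists s.
  by rewrite E addrK.
case/negP: am; apply: (maxm I) => // [b bm|]; rewrite IE; apply/asboolP.
  by exists b => //; exists 0; rewrite mulr0 addr0.
by exists 0; [exact: ideal_0 | exists 1; rewrite mulr1 add0r].
Qed.

Section ResidueField.
Variables (m : ideal R) (maxm : maximal_ideal m).

Let mpred : {pred R} := fun a => a \in m.

Fact mpred_idealr : idealr_closed mpred.
Proof.
split; rewrite -?topredE /= /mpred; [exact: ideal_0 | by case: maxm|].
by move=> a b c bm cm; apply: ideal_add => //; exact: ideal_mull.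
Qed.

Let mI : idealr R := HB.pack mpred (isIdealr.Build R mpred mpred_idealr).
Let L := Quotient.quot mI.
Let pi (a : R) : L := (\pi_L a)%qT.

Let piE a b : (pi a == pi b) = (a - b \in m).
Proof. by rewrite /pi -Quotient.idealrBE. Qed.

(** The default 0 is only taken at 0, where the field structure prescribes it. *)
Let inv (x : L) : L :=
  if pselect (exists y : L, x * y = 1) is left h then projT1 (cid h) else 0.

Let invP (x : L) : x != 0 -> inv x * x = 1.
Proof.
move=> x0; rewrite /inv; case: pselect => [h|[]].
  by rewrite mulrC; case: cid.
have xE : x = pi (repr x) by rewrite /pi reprK.
have [|b hb] := @maximal_ideal_inv m (repr x) maxm.
  apply: contra x0 => xm; rewrite xE (_ : 0 = pi 0) ?piE ?subr0 //.
  by rewrite /pi rmorph0.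
exists (pi b); rewrite {1}xE /pi -rmorphM -(rmorph1 (\pi_L)%qT).
by apply/eqP; rewrite eq_sym [_ == _]piE.
Qed.

Let inv0 : inv 0 = 0.
Proof.
rewrite /inv; case: pselect => // h; exfalso; case: h => y.
by rewrite mul0r => /esym/eqP; rewrite (negPf (oner_neq0 _)).
Qed.

Lemma residue_field :
  exists (L : fieldType) (pi : {rmorphism R -> L}),
    (forall x, exists a, pi a = x) /\ (forall a, (pi a == 0) = (a \in m)).
Proof.
pose F : fieldType := HB.pack (L : Type) (GRing.Zmodule.on L)
  (GRing.ComNzRing.on L)
  (GRing.ComNzRing_isField.Build L invP inv0).
pose ad := GRing.isZmodMorphism.Build R F pi (rmorphB (\pi_L)%qT).
pose mu := GRing.isMonoidMorphism.Build R F pi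
  (rmorph1 (\pi_L)%qT, rmorphM (\pi_L)%qT).
pose f : {rmorphism R -> F} := HB.pack (pi : R -> F) ad mu.
exists F, f; split=> [x|a] /=.
  by exists (repr (x : L)); exact: reprK.
by rewrite -[a in RHS]subr0 -piE /pi rmorph0.
Qed.

End ResidueField.
End Ideals.

(** * Purely inseparable elements *)

Section PurelyInseparable.
Variables (p : nat) (L : fieldType) (charLp : p \in [pchar L]).
Variable F : set L.
Hypotheses (F1 : F 1) (FB : forall a b, F a -> F b -> F (a - b))
  (FM : forall a b, F a -> F b -> F (a * b)) (FV : forall a, F a -> F a^-1).

Let F0 : F 0. Proof. by rewrite -(subrr 1); exact: FB. Qed.
Let FN a : F a -> F (- a). Proof. by rewrite -sub0r; exact: FB. Qed.
Let FD a b : F a -> F b -> F (a + b).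
Proof. by move=> Fa Fb; rewrite -[b]opprK; apply/FB/FN. Qed.

Let over (q : {poly L}) := forall i, F q`_i.

Let over_reduce (q g : {poly L}) i : over q -> over g ->
  over (q - lead_coef q *: ('X^i * g)).
Proof.
move=> Fq Fg j; rewrite coefB coefZ coefXnM; apply: FB => //; apply: FM.
  exact: Fq.
by case: ifP.
Qed.

(* The monic polynomial g of least degree over F that vanishes at l divides
   X^p - l^p = (X - l)^p, so g = (X - l)^j, and j < p would put l in F. *)
Lemma purely_inseparable_free (l : L) :
  ~ F l -> F (l ^+ p) -> forall q : {poly L},
  (forall i, F q`_i) -> (size q <= p)%N -> q.[l] = 0 -> q = 0.
Proof.
move=> nFl Flp q0 Fq0 sq0 rq0; apply/eqP/negP => /negP q0N0.
pose P n := `[< exists g : {poly L}, [/\ over g, g != 0, g.[l] = 0 & size g = n]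
  >].
have exP : exists n, P n by exists (size q0); apply/asboolP; exists q0.
case: (ex_minnP exP) => n /asboolP [g1 [Fg1 g1N0 rg1 sg1]] min_n.
pose g := (lead_coef g1)^-1 *: g1.
have lc0 : (lead_coef g1)^-1 != 0 by rewrite invr_eq0 lead_coef_eq0.
have Fg : over g by move=> i; rewrite coefZ; apply: FM => //; apply/FV/Fg1.
have gmon : lead_coef g = 1 by rewrite lead_coefZ mulVf // lead_coef_eq0.
have rg : g.[l] = 0 by rewrite hornerZ rg1 mulr0.
have sg : size g = n by rewrite size_scale.
have n_le_p : (n <= p)%N.
  by apply: leq_trans sq0; apply: min_n; apply/asboolP; exists q0.
have gN0 : g != 0 by rewrite -lead_coef_eq0 gmon oner_eq0.
(* Division by the monic g stays over F: u has the same leading term as h, and minimality of n gives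
   n <= [size h]. *)
have g_dvd h : over h -> h.[l] = 0 -> g %| h.
  have [k] := ubnP (size h); elim: k h => // k IHk h sh Fh rh.
  have [->|hN0] := eqVneq h 0; first exact: dvdp0.
  have n_le_h : (n <= size h)%N by apply: min_n; apply/asboolP; exists h.
  pose u := lead_coef h *: ('X^(size h - n) * g).
  have su : size u = size h.
    rewrite size_scale ?lead_coef_eq0 // mulrC size_mulXn // sg subnK //.
  rewrite -(subrK u h) dvdp_add //; last first.
    by rewrite /u dvdpZr ?lead_coef_eq0 // dvdp_mull.
  apply: IHk; last 1 first.
  - by rewrite hornerD hornerN rh /u hornerZ hornerM rg !mulr0 subrr.
  - apply: leq_trans (_ : size h <= k)%N => //.
    have hlc : lead_coef u = lead_coef h.
      by rewrite lead_coefZ lead_coefM lead_coefXn gmon !mulr1.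
    rewrite -[X in (_ < X)%N]prednK ?size_poly_gt0 // ltnS.
    apply/leq_sizeP => j hj; rewrite coefB.
    case: (ltngtP j (size h).-1) hj => // [hj _|-> _].
      have hj' : (size h <= j)%N by rewrite -(prednK (_ : 0 < size h)%N)
        ?size_poly_gt0.
      by rewrite !nth_default ?subrr ?su.
    by move: hlc; rewrite /lead_coef su => ->; rewrite subrr.
  - exact: over_reduce.
have pXl : 'X^p - (l ^+ p)%:P = ('X - l%:P) ^+ p.
  have cP : p \in [pchar {poly L}] by rewrite (rmorph_pchar (@polyC L)).
  by rewrite -[RHS](pFrobenius_autE cP) rmorphB /= !pFrobenius_autE rmorphXn.
have /dvdp_exp_XsubCP [j lejp gE] : g %| ('X - l%:P) ^+ p.
  rewrite -pXl; apply: g_dvd => [i|]; last by rewrite !hornerE subrr.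
  rewrite coefB coefXn coefC; apply: FB; first by case: (i == p).
  by case: (i == 0%N).
have {}gE : g = ('X - l%:P) ^+ j.
  apply/eqP; rewrite -eqp_monic //; first by apply/eqP.
  by rewrite monic_exp // monicXsubC.
have jE : n = j.+1 by rewrite -sg gE size_exp_XsubC.
case: j => [|j] in gE jE lejp *.
  by move: rg; rewrite gE expr0 hornerC; move/eqP; rewrite oner_eq0.
(* The coefficient of X^j in (X - l)^(j+1) is -(j+1) l; since j + 1 < p, dividing by j + 1 puts l in
   F. *)
have j1_neq0 : j.+1%:R != 0 :> L.
  rewrite -(dvdn_pcharf charLp) gtnNdvd //; apply: leq_trans n_le_p.
  by rewrite jE.
have := Fg j; rewrite gE.
have -> : ('X - l%:P) ^+ j.+1 = \prod_(a <- nseq j.+1 l) ('X - a%:P).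
  by rewrite big_nseq -Monoid.iteropE.
have := @coefPn_prod_XsubC _ (nseq j.+1 l).
rewrite size_nseq => -> //; rewrite big_nseq -Monoid.iteropE /= => Fl.
apply: nFl; rewrite -(mulKf j1_neq0 l); apply: FM.
  by apply: FV; elim: j.+1 => // k IHk; rewrite -addn1 natrD; exact: FD.
rewrite mulr_natl -[_ *+ _]opprK; exact: FN.
Qed.

End PurelyInseparable.

(** * Adic completeness *)

Section Adic.
Variables (R : comNzRingType) (m : ideal R).
Hypotheses (maxm : maximal_ideal m) (complR : adic_complete m).
Implicit Types (a b x y : R) (c : nat -> R).

Lemma mem_ideal_powS n a b :
  a \in m -> b \in ideal_pow m n -> a * b \in ideal_pow m n.+1.
Proof. by move=> am bm; apply: mem_span; exists a, b. Qed.

Lemma mem_ideal_pow0 a : a \in ideal_pow m 0.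
Proof. exact: mem_span. Qed.

Lemma mem_ideal_pow_exp n a y : y \in m -> a * y ^+ n \in ideal_pow m n.
Proof.
move=> ym; elim: n => [|n IHn]; first exact: mem_ideal_pow0.
by rewrite exprS mulrCA; exact: mem_ideal_powS.
Qed.

Lemma ideal_pow_decr n : {subset ideal_pow m n.+1 <= ideal_pow m n}.
Proof. by apply: span_min => _ [a [b [am bm ->]]]; exact: ideal_mull. Qed.

Lemma ideal_pow_anti n k : (n <= k)%N -> {subset ideal_pow m k <= ideal_pow m
  n}.
Proof.
by move=> nk; rewrite -(subnK nk); elim: (k - n)%N => // j IHj a /ideal_pow_decr
  /IHj.
Qed.

Lemma ideal_pow1 : {subset ideal_pow m 1 <= m}.
Proof. by apply: span_min => _ [a [b [am bm ->]]]; exact: ideal_mulr. Qed.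

(** The constant sequence 0 would converge both to 0 and to a. *)
Lemma adic_separated a : (forall n, a \in ideal_pow m n) -> a = 0.
Proof.
move=> a_pow; have lim0 : adic_limit m (fun=> 0) 0.
  by move=> n; exists 0%N => i _; rewrite subrr; exact: ideal_0.
have lima : adic_limit m (fun=> 0) a.
  by move=> n; exists 0%N => i _; rewrite sub0r; apply/ideal_opp.
have [|l [_ uniq]] := complR (a := fun=> 0).
  by move=> n; exists 0%N => i j _ _; rewrite subrr; exact: ideal_0.
by rewrite -(uniq _ lima) (uniq _ lim0).
Qed.

Lemma separated_var y a :
  y \in m -> (forall n, exists s, a = s * y ^+ n) -> a = 0.
Proof.
move=> ym ay; apply: adic_separated => n; have [s ->] := ay n.
exact: mem_ideal_pow_exp.
Qed.

(** [S c] is the limit of the partial sums of c_i y^i; the recursion, which splits off the constant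
    term, is the only property used afterwards. *)
Lemma power_series_sum y : y \in m ->
  exists S : (nat -> R) -> R, forall c, S c = c 0%N + y * S (c \o succn).
Proof.
move=> ym; pose part c n := \sum_(i < n) c i * y ^+ i.
have part_tail c n k : part c (n + k)%N - part c n \in ideal_pow m n.
  rewrite /part big_split_ord /= addrAC subrr add0r.
  elim/big_ind: _ => [|a b|i _]; [exact: ideal_0 | exact: ideal_add|].
  by rewrite exprD mulrCA mulrC; exact: mem_ideal_pow_exp.
have cauchy c : adic_cauchy m (part c).
  move=> n; exists n => i j ni nj; rewrite -(subnKC ni) -(subnKC nj).
  set u := part _ (n + _)%N; set v := part _ (n + _)%N.
  rewrite (_ : u - v = (u - part c n) - (v - part c n)); last by ring.
  by apply: ideal_sub; exact: part_tail.
pose S c := projT1 (cid (complR (cauchy c))).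
have limS c : adic_limit m (part c) (S c) by rewrite /S; case: cid => l [].
have uniqS c l : adic_limit m (part c) l -> S c = l.
  by move=> liml; rewrite /S; case: cid => l' [_ uniq] /=; exact: uniq.
exists S => c; apply: uniqS => n; have [N SN] := limS (c \o succn) n.
exists N.+1 => -[//|i] iN.
have -> : part c i.+1 = c 0%N + y * part (c \o succn) i.
  rewrite /part big_ord_recl expr0 mulr1 mulr_sumr; congr (_ + _).
  by apply: eq_bigr => j _; rewrite /= exprS; ring.
rewrite opprD addrACA subrr add0r -mulrBr; apply: ideal_mull; exact: SN.
Qed.

(** Geometric series: if h = 1 - a b lies in m and s is the sum of all h^i, then s = 1 + h s, that
    is, a b s = 1. *)
Lemma inv_notin_max a : a \notin m -> exists b, a * b = 1.
Proof.
move=> am; have [b hm] := maximal_ideal_inv maxm am.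
have [S SE] := power_series_sum hm; exists (b * S (fun=> 1)).
have := SE (fun=> 1); rewrite /comp /= => E.
rewrite mulrA; set s := S _ in E *.
have -> : a * b * s = s - (1 - a * b) * s by ring.
by rewrite {1}E addrK.
Qed.

End Adic.

(** * Linear combinations over a subring *)

Section Combinations.
Variable R : comNzRingType.
Implicit Types (A B : set R) (xs ys zs bs : seq R) (a b r s : R).

Definition subring A : Prop :=
  [/\ A 1, forall a b, A a -> A b -> A (a - b)
    & forall a b, A a -> A b -> A (a * b)].

Section SubringTheory.
Variables (A : set R) (ringA : subring A).

Lemma subring1 : A 1. Proof. by case: ringA. Qed.
Lemma subringB a b : A a -> A b -> A (a - b). Proof. by case: ringA => _ + _;
  apply. Qed.
Lemma subringM a b : A a -> A b -> A (a * b). Proof. by case: ringA => _ _;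
  apply. Qed.
Lemma subring0 : A 0.
Proof. by rewrite -(subrr 1); apply: subringB; exact: subring1. Qed.
Lemma subringN a : A a -> A (- a).
Proof. by rewrite -sub0r; apply: subringB; exact: subring0. Qed.
Lemma subringD a b : A a -> A b -> A (a + b).
Proof. by move=> Aa Ab; rewrite -[b]opprK; apply/subringB/subringN. Qed.
Lemma subringX a n : A a -> A (a ^+ n).
Proof.
move=> Aa; elim: n => [|n IHn]; first by rewrite expr0; exact: subring1.
by rewrite exprS; exact: subringM.
Qed.

Lemma subring_sum (I : Type) (t : seq I) (P : pred I) (F : I -> R) :
  (forall i, P i -> A (F i)) -> A (\sum_(i <- t | P i) F i).
Proof. by move=> AF; elim/big_ind: _ => //; [exact: subring0 | exact: subringD].
  Qed.

End SubringTheory.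

Definition lin B bs : set R :=
  [set r | exists2 c : nat -> R, forall i, B (c i)
                               & r = \sum_(i < size bs) c i * bs`_i].

(** The ideal generated by a list, as explicit combinations; [ideal_genP] compares it with
    [ideal_gen]. *)
Definition gen : seq R -> set R := lin setT.

Lemma lin_nil B r : B 0 -> lin B [::] r <-> r = 0.
Proof.
move=> B0; split=> [[c _ ->]|->]; first by rewrite big_ord0.
by exists (fun=> 0) => //; rewrite big_ord0.
Qed.

Lemma lin_cons B b bs r :
  lin B (b :: bs) r <-> exists a s, [/\ B a, lin B bs s & r = a * b + s].
Proof.
split=> [[c Bc ->]|[a [s [Ba [c Bc ->] ->]]]].
  exists (c 0%N), (\sum_(i < size bs) c i.+1 * bs`_i).
  split; [exact: Bc | by exists (c \o succn) => [i|]; [exact: Bc|] |].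
  by rewrite big_ord_recl.
exists (fun i => if i is j.+1 then c j else a) => [[|i] //|].
by rewrite big_ord_recl.
Qed.

Lemma lin0 B bs : B 0 -> lin B bs 0.
Proof.
by move=> B0; exists (fun=> 0) => //; rewrite big1 // => i _; rewrite mul0r.
Qed.

Lemma linD B bs r s : (forall a b, B a -> B b -> B (a + b)) ->
  lin B bs r -> lin B bs s -> lin B bs (r + s).
Proof.
move=> BD [c Bc ->] [d Bd ->]; exists (fun i => c i + d i) => [i|];
  first exact: BD.
by rewrite -big_split; apply: eq_bigr => i _; rewrite mulrDl.
Qed.

Lemma linZ (B C : set R) bs a r : (forall b, B b -> C (a * b)) ->
  lin B bs r -> lin C bs (a * r).
Proof.
move=> BC [c Bc ->]; exists (fun i => a * c i) => [i|]; first exact: BC.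
by rewrite mulr_sumr; apply: eq_bigr => i _; rewrite mulrA.
Qed.

Lemma lin_mulr B bs a r : lin B bs r -> lin B (map (fun b => a * b) bs) (a * r).
Proof.
move=> [c Bc ->]; exists c => //; rewrite size_map mulr_sumr.
by apply: eq_bigr => i _; rewrite (nth_map 0) // mulrCA.
Qed.

Lemma lin_mem B bs b : B 0 -> B 1 -> b \in bs -> lin B bs b.
Proof.
move=> B0 B1; elim: bs => // b' bs IHbs; rewrite inE => /predU1P[->|/IHbs b_bs].
  by apply/lin_cons; exists 1, 0; split=> //;
    [exact: lin0 | rewrite mul1r addr0].
by apply/lin_cons; exists 0, b; split=> //; rewrite mul0r add0r.
Qed.

Lemma lin_cat B xs ys r : B 0 ->
  lin B (xs ++ ys) r <-> exists a b, [/\ lin B xs a, lin B ys b & r = a + b].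
Proof.
move=> B0; elim: xs r => [|x xs IHxs] r /=.
  split=> [ys_r|[a [b [/(lin_nil _ B0)-> ys_b ->]]]]; last by rewrite add0r.
  by exists 0, r; split; rewrite ?add0r //; apply/lin_nil.
split=> [/lin_cons[a [s [Ba /IHxs[a' [b [xs_a' ys_b ->]]] ->]]]|].
  exists (a * x + a'), b; split; rewrite ?addrA //.
  by apply/lin_cons; exists a, a'.
move=> [_ [b [/lin_cons[a [s [Ba xs_s ->]]] ys_b ->]]].
apply/lin_cons; exists a, (s + b); split; rewrite ?addrA //.
by apply/IHxs; exists s, b.
Qed.

Lemma sub_lin (B C : set R) bs : B `<=` C -> lin B bs `<=` lin C bs.
Proof. by move=> BC r [c Bc ->]; exists c => // i; apply/BC. Qed.

Lemma gen0 zs : gen zs 0. Proof. exact: lin0. Qed.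
Lemma genD zs r s : gen zs r -> gen zs s -> gen zs (r + s).
Proof. exact: linD. Qed.
Lemma genMl zs a r : gen zs r -> gen zs (a * r).
Proof. exact: linZ. Qed.
Lemma genMr zs a r : gen zs r -> gen zs (r * a).
Proof. by rewrite mulrC; exact: genMl. Qed.
Lemma genN zs r : gen zs r -> gen zs (- r).
Proof. by rewrite -mulN1r; exact: genMl. Qed.
Lemma genB zs r s : gen zs r -> gen zs s -> gen zs (r - s).
Proof. by move=> zr zs'; apply/genD/genN. Qed.
Lemma gen_mem zs z : z \in zs -> gen zs z.
Proof. exact: lin_mem. Qed.

Lemma gen_sub xs zs : (forall x, x \in xs -> gen zs x) -> gen xs `<=` gen zs.
Proof.
elim: xs => [|x xs IHxs] xz r; first by move=> /(lin_nil _ I)->; exact: gen0.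
move=> /lin_cons[a [s [_ xs_s ->]]]; apply: genD.
  by apply/genMl/xz; rewrite mem_head.
by apply: IHxs xs_s => y yxs; apply: xz; rewrite inE yxs orbT.
Qed.

Lemma gen_subseq xs zs : {subset xs <= zs} -> gen xs `<=` gen zs.
Proof. by move=> xz; apply: gen_sub => x /xz; exact: gen_mem. Qed.

Lemma gen_ideal (I : ideal R) zs :
  (forall z, z \in zs -> z \in I) -> forall r, gen zs r -> r \in I.
Proof.
elim: zs => [|z zs IHzs] zI r; first by move=> /(lin_nil _ Logic.I)->;
  exact: ideal_0.
move=> /lin_cons[a [s [_ zs_s ->]]]; apply: ideal_add.
  by apply/ideal_mull/zI; rewrite mem_head.
by apply: IHzs zs_s => y yzs; apply: zI; rewrite inE yzs orbT.
Qed.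

Lemma ideal_genP zs r : r \in ideal_gen zs <-> gen zs r.
Proof.
split; last by apply: gen_ideal => z zzs; exact: mem_span.
have [|||J JE] := @submod_of R R^o (gen zs).
- exact: gen0.
- by move=> a b; exact: genD.
- by move=> a b; exact: genMl.
move=> rz; apply/asboolP; rewrite -JE; apply: (span_min _ rz) => y /= yzs.
by rewrite JE; apply/asboolP/gen_mem.
Qed.

Definition power_in (zs : seq R) a : Prop := exists n, gen zs (a ^+ n).

End Combinations.

(** * Values of power series *)

Section PowerSeries.
Variable R : comNzRingType.
Implicit Types (A B K : set R) (y r s a b : R) (ys bs zs : seq R).

(* The values at y of the power series with coefficients in B, as the greatest
   X such that every element of X is b + y * s with b in B and s in X. *)
Definition series B y : set R :=
  [set r | exists X : set R, X r /\
     forall s, X s -> exists b t, [/\ B b, X t & s = b + y * t]].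

(** The head of the list is the outermost variable: its coefficients are series in the variables of
    the tail. *)
Fixpoint multi_series K ys : set R :=
  if ys is y :: ys' then series (multi_series K ys') y else K.

Lemma series_step B y r : series B y r ->
  exists b s, [/\ B b, series B y s & r = b + y * s].
Proof.
by move=> [X [Xr HX]]; have [b [s [Bb Xs ->]]] := HX _ Xr; exists b, s;
  split=> //; exists X.
Qed.

Lemma sub_series B y : B 0 -> B `<=` series B y.
Proof.
move=> B0 b Bb; exists B; split=> // s Bs.
by exists s, 0; split; rewrite // mulr0 addr0.
Qed.

Lemma series_cons B y b s : B b -> series B y s -> series B y (b + y * s).
Proof.
move=> Bb [X [Xs HX]]; exists [set r | r = b + y * s \/ X r]; split;
  first by left.
move=> r [->|/HX [b' [t [Bb' Xt ->]]]]; first by exists b, s; split=> //; right.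
by exists b', t; split=> //; right.
Qed.

Lemma series_subring B y : subring B -> subring (series B y).
Proof.
move=> ringB; have B0 := subring0 ringB.
have serB a b : series B y a -> series B y b -> series B y (a - b).
  (* Coinduction: the set of all differences of two series serves as X. *)
  move=> ya yb; exists [set r | exists a b, [/\ series B y a, series B y b & r =
    a - b]].
  split; first by exists a, b.
  move=> _ [c [d [/series_step[a0 [a' [Ba ya' ->]]] /series_step[b0 [b' [Bb yb'
    ->]]] ->]]].
  exists (a0 - b0), (a' - b'); split; [exact: subringB|by exists a', b'|by
    ring].
have ser0 : series B y 0 by exact: sub_series.
have serD a b : series B y a -> series B y b -> series B y (a + b).
  move=> ya yb; have -> : a + b = a - (0 - b) by ring.
  by apply: (serB) => //; exact: serB.
split=> //; first by apply: sub_series => //; exact: subring1.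
(* (a0 + y a') (b0 + y b') = a0 b0 + y (a0 b' + a' b): sums of products of
   two series are stable under dropping the constant term and dividing by y *)
move=> a b ya yb.
pose X := [set r | exists t : seq (R * R),
  (forall u, u \in t -> series B y u.1 /\ series B y u.2) /\
  r = \sum_(u <- t) u.1 * u.2].
exists X; split.
  exists [:: (a, b)]; split; last by rewrite big_seq1.
  by move=> u; rewrite inE => /eqP->.
move=> _ [t [ht ->]]; elim: t ht => [|u t IHt] ht.
  exists 0, 0; split=> //; last by rewrite big_nil mulr0 addr0.
  by exists [::]; rewrite big_nil.
have [|c [s [Bc [t' [ht' ->]] E]]] := IHt.
  by move=> w wt; apply: ht; rewrite inE wt orbT.
have [] := ht u (mem_head _ _).
case: u {ht} => /= _ u2 /series_step[a0 [a' [Ba ya' ->]]].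
move=> /[dup] yu2 /series_step[b0 [b' [Bb yb' Eu]]].
exists (a0 * b0 + c), (a0 * b' + (a' * u2 + \sum_(v <- t') v.1 * v.2)); split.
- by apply: subringD => //; exact: subringM.
- exists ((a0, b') :: (a', u2) :: t'); split; last by rewrite !big_cons.
  move=> v; rewrite !inE => /or3P[/eqP->|/eqP->|/ht'] //.
  by split=> //; exact: sub_series.
- by rewrite big_cons E /= mulrDl {1}Eu; ring.
Qed.

Lemma multi_series_subring K ys : subring K -> subring (multi_series K ys).
Proof. by move=> ringK; elim: ys => [|y ys IHys] /=;
  [|exact: series_subring]. Qed.

Lemma series_var B y : subring B -> series B y y.
Proof.
move=> ringB; rewrite -[X in series _ _ X]add0r -[X in _ + X]mulr1.
apply: series_cons; first exact: subring0.
by apply: sub_series; [exact: subring0 | exact: subring1].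
Qed.

Lemma multi_series_var K ys y : subring K -> y \in ys -> multi_series K ys y.
Proof.
move=> ringK; elim: ys => //= z ys IHys; have ringA := multi_series_subring ys
  ringK.
rewrite inE => /predU1P[->|/IHys]; first exact: series_var.
by apply: sub_series; exact: subring0.
Qed.

End PowerSeries.

(** * Finiteness over the values of power series *)

Section Finiteness.
Variables (R : comNzRingType) (m : ideal R).
Hypothesis complR : adic_complete m.
Implicit Types (B K : set R) (y r : R) (ys bs zs : seq R).

Lemma series_sumP B y (S : (nat -> R) -> R) :
  (forall c, S c = c 0%N + y * S (c \o succn)) ->
  forall c, (forall i, B (c i)) -> series B y (S c).
Proof.
move=> SE c Bc; exists [set r | exists2 c, forall i, B (c i) & r = S c].
split=> [|_ [d Bd ->]]; first by exists c.
exists (d 0%N), (S (d \o succn)); split; rewrite -?SE //.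
by exists (d \o succn) => // i; exact: Bd.
Qed.

(* Write r = l + g + y r' with l in [lin B bs] and g in [gen ps], and iterate on
   r'; the coefficients met on the way are those of the power series. *)
Lemma lin_series B y bs ps : y \in m ->
  (forall r, exists a b, [/\ lin B bs a, gen (y :: ps) b & r = a + b]) ->
  forall r, exists a b, [/\ lin (series B y) bs a, gen ps b & r = a + b].
Proof.
move=> ym span_y.
have [S SE] := power_series_sum complR ym.
have step r : exists u : (nat -> R) * (nat -> R) * R, (forall i, B (u.1.1 i)) /\
  r = \sum_(i < size bs) u.1.1 i * bs`_i
      + \sum_(i < size ps) u.1.2 i * ps`_i + y * u.2.
  have [_ [_ [[c Bc ->] /lin_cons[r' [_ [_ [d _ ->] ->]]] ->]]] := span_y r.
  by exists (c, d, r'); split=> //=; ring.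
have {step} /choice [st stP] := step.
(* [cf r n i] and [df r n i] are the coefficients met at the n-th iteration from r; [C] and [D] sum
   them as power series in y. *)
pose cf r n i := (st (iter n (fun r => (st r).2) r)).1.1 i.
pose df r n i := (st (iter n (fun r => (st r).2) r)).1.2 i.
pose C r i := S (fun n => cf r n i).
pose D r i := S (fun n => df r n i).
pose T r := \sum_(i < size bs) C r i * bs`_i + \sum_(i < size ps) D r i * ps`_i.
have CE r i : C r i = (st r).1.1 i + y * C (st r).2 i.
  rewrite {1}/C SE; congr (_ + y * S _); apply/funext => n.
  by rewrite /comp /cf iterSr.
have DE r i : D r i = (st r).1.2 i + y * D (st r).2 i.
  rewrite {1}/D SE; congr (_ + y * S _); apply/funext => n.
  by rewrite /comp /df iterSr.
have TE r : r - T r = y * ((st r).2 - T (st r).2).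
  have -> : T r = \sum_(i < size bs) (st r).1.1 i * bs`_i
      + \sum_(i < size ps) (st r).1.2 i * ps`_i + y * T (st r).2.
    rewrite /T mulrDr !mulr_sumr [RHS]addrACA -!big_split /=.
    by congr (_ + _); apply: eq_bigr => i _; [rewrite CE | rewrite DE]; ring.
  by rewrite {1}(stP r).2 mulrBr; ring.
move=> r; exists (\sum_(i < size bs) C r i * bs`_i), (\sum_(i < size ps) D r i *
  ps`_i).
split; last 1 first.
(* By [TE], r - T r is y times the same difference for the next r, hence divisible by every y^n and
   zero by separatedness. *)
- apply/eqP; rewrite -subr_eq0; apply/eqP; rewrite -/(T r).
  apply: (separated_var complR ym) => n.
  exists (iter n (fun r => (st r).2) r - T (iter n (fun r => (st r).2) r)).
  elim: n r => [|n IHn] r; first by rewrite expr0 mulr1.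
  by rewrite [LHS]TE [X in y * X]IHn iterSr exprS mulrCA.
- exists (C r) => // i; apply: series_sumP => // n; exact: (stP _).1.
- by exists (D r).
Qed.

(** A complete form of Nakayama's lemma: each use of [lin_series] turns one generator of the ideal
    into a variable of the coefficient ring. *)
Lemma lin_multi_series K ys bs ps : (forall y, y \in ys -> y \in m) ->
  (forall r, exists a b, [/\ lin K bs a, gen (ys ++ ps) b & r = a + b]) ->
  forall r, exists a b, [/\ lin (multi_series K ys) bs a, gen ps b & r = a + b].
Proof.
elim: ys ps => [|y ys IHys] ps //= ysm spanK.
apply: lin_series; first by apply: ysm; rewrite mem_head.
apply: IHys => [z zys|r]; first by apply: ysm; rewrite inE zys orbT.
have [a [b [Ka yb ->]]] := spanK r; exists a, b; split=> //.
by apply: gen_subseq yb => z; rewrite !inE !mem_cat !inE orbCA.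
Qed.

End Finiteness.

(** * Determinant trick and contraction of primes *)

Section Determinant.
Variables (R : comNzRingType) (B : set R) (ringB : subring B).

Lemma det_subring n (M : 'M[R]_n) : (forall i j, B (M i j)) -> B (\det M).
Proof.
move=> BM; apply: subring_sum => // s _; apply: subringM => //.
  by apply: subringX => //; apply: subringN => //; exact: subring1.
by elim/big_ind: _ => //; [exact: subring1 | exact: subringM].
Qed.

Lemma poly_subring : subring [set q : {poly R} | forall i, B q`_i].
Proof.
split=> [i|q r Bq Br i|q r Bq Br i].
- by rewrite coef1; case: (i == 0%N); [exact: subring1 | exact: subring0].
- by rewrite coefB; exact: subringB.
- by rewrite coefM; apply: subring_sum => // j _; exact: subringM.
Qed.

End Determinant.

Lemma char_poly_subring (R : comNzRingType) (B : set R) n (M : 'M[R]_n) :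
  subring B -> (forall i j, B (M i j)) -> forall i, B (char_poly M)`_i.
Proof.
move=> ringB BM; apply: (det_subring (poly_subring ringB)) => i j k.
rewrite !mxE coefB coefMn coefX coefC; apply: subringB => //.
  case: (i == j); rewrite ?mulr0n ?mulr1n; last exact: subring0.
  by case: (k == 1%N); [exact: subring1 | exact: subring0].
by case: (k == 0%N) => //; exact: subring0.
Qed.

Lemma horner_char_poly (R : comNzRingType) n (M : 'M[R]_n) (g : R) :
  (char_poly M).[g] = \det (g%:M - M).
Proof.
rewrite -[LHS]/(horner_eval g _) -det_map_mx; congr (\det _).
apply/matrixP => i j; rewrite !mxE.
by rewrite rmorphB rmorphMn /= /horner_eval hornerX hornerC.
Qed.

Section Contraction.
Variables (R : comNzRingType) (B : set R) (ringB : subring B).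
Variables (P I : ideal R) (primeP : prime_ideal P) (PI : {subset P <= I}).

(** Write q = q' X + c. If c is not in P, it is the element sought, as c = q(g) - q'(g) g lies in I.
    If c is in P, then so is q'(g) g, hence q'(g), because P is prime and g is outside P; the
    induction goes on with q'. *)
Lemma root_contraction (q : {poly R}) g : g \in I -> g \notin P ->
  (forall i, B q`_i) -> q.[g] \in P -> (exists i, q`_i \notin P) ->
  exists a, [/\ B a, a \in I & a \notin P].
Proof.
move=> gI gP; elim/poly_ind: q => [|q c IHq] Bq.
  by move=> _ [i]; rewrite coef0 ideal_0.
have Eq i : (q * 'X + c%:P)`_i.+1 = q`_i.
  by rewrite coefD coefMX coefC /= addr0.
have E0 : (q * 'X + c%:P)`_0 = c by rewrite coefD coefMX coefC /= add0r.
rewrite !hornerE => qP [i iP].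
have [cP|cP] := boolP (c \in P); last first.
  exists c; split=> //; first by rewrite -E0.
  have -> : c = (q.[g] * g + c) - q.[g] * g by ring.
  by apply: ideal_sub; [exact: PI | exact: ideal_mull].
apply: IHq => [j|| ]; first by rewrite -Eq.
  have qgP : q.[g] * g \in P.
    have -> : q.[g] * g = (q.[g] * g + c) - c by ring.
    exact: ideal_sub.
  by have := primeP.2 _ _ qgP; rewrite (negPf gP) orbF.
case: i iP => [|i]; first by rewrite E0 cP.
by rewrite Eq => iP; exists i.
Qed.

(** Multiplication by an element g of I outside P is given on [bs] modulo P by a matrix over [B].
    Its characteristic polynomial vanishes at g modulo P and, being monic, has a coefficient outside
    P. *)
Lemma finite_contraction (bs : seq R) :
  (forall r, exists a b, [/\ lin B bs a, b \in P & r = a + b]) ->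
  ~ {subset I <= P} -> exists a, [/\ B a, a \in I & a \notin P].
Proof.
move=> spanB /existsNP[g /not_implyP[gI /negP gP]].
have /choice[cf cfP] (i : 'I_(size bs)) : exists c : 'I_(size bs) -> R,
    (forall j, B (c j)) /\ g * bs`_i - \sum_j c j * bs`_j \in P.
  have [_ [b [[c Bc ->] bP E]]] := spanB (g * bs`_i).
  by exists c; split=> //; rewrite E addrAC subrr add0r.
pose M := \matrix_(i, j) cf i j.
pose v := \col_(i < size bs) bs`_i.
have NvP i : ((g%:M - M) *m v) i 0 \in P.
  rewrite mulmxBl mul_scalar_mx !mxE.
  by under eq_bigr do rewrite !mxE; exact: (cfP i).2.
have detbP (i : 'I_(size bs)) : \det (g%:M - M) * bs`_i \in P.
  have -> : \det (g%:M - M) * bs`_i = (\adj (g%:M - M) *m ((g%:M - M) *m v)) i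
    0.
    by rewrite mulmxA mul_adj_mx mul_scalar_mx !mxE.
  rewrite mxE; elim/big_ind: _ => [|a b|j _];
    [exact: ideal_0|exact: ideal_add|].
  exact: ideal_mull.
apply: (@root_contraction (char_poly M) g) => //.
- by apply: char_poly_subring => // i j; rewrite mxE; exact: (cfP i).1.
(* The determinant kills every entry of [bs] modulo P, and 1 is a combination of these entries
   modulo P. *)
- rewrite horner_char_poly -[\det _]mulr1.
  have [_ [b [[c Bc ->] bP ->]]] := spanB 1.
  rewrite mulrDr mulr_sumr; apply: ideal_add; last exact: ideal_mull.
  elim/big_ind: _ => [|a b'|j _]; [exact: ideal_0|exact: ideal_add|].
  by rewrite mulrCA; apply: ideal_mull.
- exists (size (char_poly M)).-1.
  by rewrite -/(lead_coef _) (monicP (char_poly_monic M)); case: primeP.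
Qed.

End Contraction.

(** * Systems of parameters over a coefficient field *)

Section OverCoefficientField.
Variables (R : idomainType) (m : ideal R).
Hypotheses (noethR : noetherian R) (maxm : maximal_ideal m).
Hypothesis complR : adic_complete m.
Variable K : set R.
Hypotheses (ringK : subring K) (Km : forall a, K a -> a \in m -> a = 0).
Hypothesis KR : forall r, exists2 k, K k & r - k \in m.
Implicit Types (a b r s u y z : R) (xs ys zs ps bs : seq R).

(** R modulo the ideal of [zs] has finite dimension over [K]. *)
Definition cofinite zs : Prop := exists bs, forall r,
  exists a b, [/\ lin K bs a, gen zs b & r = a + b].

Lemma cofinite_mono xs zs :
  (forall x, x \in xs -> gen zs x) -> cofinite xs -> cofinite zs.
Proof.
move=> xz [bs span_xs]; exists bs => r; have [a [b [Ka xb ->]]] := span_xs r.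
by exists a, b; split=> //; exact: gen_sub xb.
Qed.

(** Modulo [zs], R is spanned by the b z^i with b in [bs] and i < n: the cofactor of z^i is expanded
    again and again until z^n falls into the ideal. *)
Lemma cofinite_elim1 z zs : cofinite (z :: zs) -> power_in zs z -> cofinite zs.
Proof.
move=> [bs span_z] [n zn]; have K0 := subring0 ringK.
have [bs' span_z'] : exists bs', forall r,
    exists a b s, [/\ lin K bs' a, gen zs b & r = a + b + z ^+ n * s].
  elim: n {zn} => [|n [bs' IHn]].
    exists [::] => r; exists 0, 0, r; split; [exact: lin0|exact: gen0|ring].
  exists (bs' ++ map (fun b => z ^+ n * b) bs) => r.
  have [a [b [s [Ka zb ->]]]] := IHn r.
  have [a' [_ [Ka' /lin_cons[t [b' [_ zb' ->]]] ->]]] := span_z s.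
  exists (a + z ^+ n * a'), (b + z ^+ n * b'), t; split.
  - by apply/lin_cat => //; exists a, (z ^+ n * a'); split=> //;
    exact: lin_mulr.
  - by apply: genD => //; exact: genMl.
  - by rewrite exprSr; ring.
exists bs' => r; have [a [b [s [Ka zb ->]]]] := span_z' r.
exists a, (b + z ^+ n * s); split; rewrite ?addrA //.
by apply: genD => //; exact: genMr.
Qed.

Lemma cofinite_elim ys zs :
  (forall y, y \in ys -> power_in zs y) -> cofinite (ys ++ zs) -> cofinite zs.
Proof.
elim: ys => //= y ys IHys yz /cofinite_elim1 cof; apply: IHys => [x xys|].
  by apply: yz; rewrite inE xys orbT.
apply: cof; have [n zn] := yz y (mem_head _ _); exists n.
by apply: gen_subseq zn => z zz; rewrite mem_cat zz orbT.
Qed.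

Lemma cofinite_parameters xs :
  (forall a, a \in m -> power_in xs a) -> cofinite xs.
Proof.
move=> m_xs; have [mus muE] := noethR m.
have mu_m a : a \in mus -> a \in m by move=> /gen_mem/ideal_genP; rewrite muE.
apply: (@cofinite_elim mus) => [y /mu_m /m_xs //|].
apply: (@cofinite_mono mus) => [y ymu|].
  by apply: gen_mem; rewrite mem_cat ymu.
exists [:: 1] => r; have [k Kk] := KR r; rewrite muE => /ideal_genP rk.
exists k, (r - k); split=> //; last by ring.
apply/lin_cons; exists k, 0; split=> //; last by ring.
by apply: lin0; exact: subring0.
Qed.

(** * Dimension and analytic independence *)

Lemma K_unit k : K k -> k != 0 -> k \notin m.
Proof. by move=> Kk; apply: contra_neqN => /(Km Kk). Qed.

(** If all coefficients were zero, a would be divisible by every power of y, hence zero by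
    separatedness. *)
Lemma series_leading (B : set R) y a : subring B -> y \in m ->
  series B y a -> a != 0 ->
  exists n b s, [/\ B b, b != 0, series B y s & a = y ^+ n * (b + y * s)].
Proof.
move=> ringB ym ya; apply: contra_neqP => no_lead.
apply: (separated_var complR ym) => n.
suff [s [ys ->]] : exists s, series B y s /\ a = s * y ^+ n by exists s.
elim: n => [|n [s [/series_step[b [t [Bb yt ->]]] aE]]].
  by exists a; rewrite expr0 mulr1.
have [b0|b0] := eqVneq b 0.
  by exists t; split=> //; rewrite aE b0 exprS; ring.
by case: no_lead; exists n, b, t; split=> //; rewrite aE mulrC.
Qed.

(* Substituting y := y1 ^ (w + 1) for all variables but the innermost y1, with
   weights w increasing fast enough, maps a nonzero power series to a unit
   times a power of y1. *)
Lemma weight_substitution ys y1 a :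
  (forall y, y \in rcons ys y1 -> y \in m) ->
  multi_series K (rcons ys y1) a -> a != 0 ->
  exists zs M u, [/\ size zs = size ys, forall z, z \in zs -> z \in m,
    u \notin m, gen zs (a - u * y1 ^+ M)
    & forall y, y \in ys -> exists w, gen zs (y - y1 ^+ w.+1)].
Proof.
elim: ys a => [|y ys IHys] a ysm /=.
  have y1m : y1 \in m by apply: ysm; rewrite mem_seq1.
  move=> /(series_leading ringK y1m) /[apply] -[n [b [s [Kb b0 _ ->]]]].
  exists [::], n, (b + y1 * s); split=> //; last first.
    by rewrite mulrC subrr; exact: gen0.
  apply: contra (K_unit Kb b0) => um.
  by rewrite -(addrK (y1 * s) b); apply: ideal_sub => //; exact: ideal_mulr.
have ym : y \in m by apply: ysm; rewrite mem_head.
have ysm' z : z \in rcons ys y1 -> z \in m.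
  by move=> zys; apply: ysm; rewrite /= inE zys orbT.
have y1m : y1 \in m by apply: ysm'; rewrite mem_rcons mem_head.
have ringA := multi_series_subring (rcons ys y1) ringK.
move=> /(series_leading ringA ym) /[apply] -[n [b [s [Ab b0 _ ->]]]].
have [zs [M [u [szs zsm um bu yz]]]] := IHys b ysm' Ab b0.
(* The exponent M + 1 exceeds the order M of b in y1, so the tail y s changes the unit u only by a
   multiple of y1. *)
pose z := y - y1 ^+ M.+1.
have zz : gen (z :: zs) z by apply: gen_mem; rewrite mem_head.
have zsz : gen zs `<=` gen (z :: zs).
  by apply: gen_subseq => t tzs; rewrite inE tzs orbT.
(* Modulo z and [zs], y^n becomes y1^((M+1)n), and b + y s becomes u y1^M + y1^(M+1) s = (u + y1 s)
   y1^M. *)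
exists (z :: zs), (M.+1 * n + M)%N, (u + y1 * s); split.
- by rewrite /= szs.
- move=> t; rewrite inE => /predU1P[->|/zsm //].
  by apply: ideal_sub => //; exact: ideal_exp.
- apply: contra um => um.
  by rewrite -(addrK (y1 * s) u); apply: ideal_sub => //; exact: ideal_mulr.
- have yE : y = y1 ^+ M.+1 + z by rewrite /z; ring.
  have [q qE] : exists q, y ^+ n - (y1 ^+ M.+1) ^+ n = z * q.
    by rewrite subrXX; eexists.
  have -> : y ^+ n * (b + y * s) - (u + y1 * s) * y1 ^+ (M.+1 * n + M) =
     z * (q * (b + y * s)) + (y1 ^+ M.+1) ^+ n * ((b - u * y1 ^+ M) + z * s).
    have -> : y ^+ n = z * q + (y1 ^+ M.+1) ^+ n by rewrite -qE; ring.
    by rewrite exprD exprM yE exprS; ring.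
  apply: genD; first exact: genMr.
  by apply/genMl/genD; [exact: zsz | exact: genMr].
- move=> t; rewrite inE => /predU1P[->|/yz[w wz]]; first by exists M.
  by exists w; exact: zsz.
Qed.

(** Modulo [zs], a is a unit times a power of the last variable y1, so that power lies in the ideal
    of a and [zs]; the other variables are powers of y1 modulo [zs]. *)
Lemma series_drops_parameter ys a :
  (forall y, y \in ys -> y \in m) -> multi_series K ys a -> a != 0 -> a \in m ->
  exists zs, [/\ (size zs < size ys)%N, forall z, z \in zs -> z \in m
    & forall y, y \in ys -> power_in (a :: zs) y].
Proof.
(* Without variables, a is a nonzero element of [K], hence outside m. *)
case/lastP: ys => [|ys y1] ysm Aa a0 am.
  by have := K_unit Aa a0; rewrite am.
have [zs [M [u [szs zsm um au yz]]]] := weight_substitution ysm Aa a0.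
exists zs; rewrite size_rcons szs; split=> // y.
have zsa : gen zs `<=` gen (a :: zs).
  by apply: gen_subseq => t tzs; rewrite inE tzs orbT.
have y1M : gen (a :: zs) (y1 ^+ M).
  have [v uv] := inv_notin_max maxm complR um.
  have -> : y1 ^+ M = v * (a - (a - u * y1 ^+ M)).
    by rewrite opprB addrC subrK mulrA [v * u]mulrC uv mul1r.
  by apply/genMl/genB; [exact/gen_mem/mem_head | exact: zsa].
rewrite mem_rcons inE => /predU1P[->|/yz[w wz]]; exists M => //.
rewrite -(subrK ((y1 ^+ w.+1) ^+ M) (y ^+ M)); apply: genD.
  by rewrite subrXX; apply/genMr/zsa.
by rewrite -exprM mulnC exprM exprS; apply: genMr.
Qed.

(** Induction on the number of variables. C 1 contains the value a of a series, with a outside C 0.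
    Modulo a and fewer elements [zs] the variables are nilpotent, so the chain from C 1 on, shorter
    by one, is bounded by the size of [zs]. *)
Lemma chain_length_le ys ps l (C : nat -> ideal R) :
  (forall y, y \in ys -> y \in m) -> prime_chain l C -> C 0%N =i ideal_gen ps ->
  cofinite (ys ++ ps) -> (l <= size ys)%N.
Proof.
have [n] := ubnP (size ys); elim: n ys ps l C => // n IHn ys ps [//|l] C.
rewrite ltnS => sys ysm [primeC incC] C0 cof.
have ringA := multi_series_subring ys ringK.
have {}C0 r : r \in C 0%N <-> gen ps r by rewrite C0; exact: ideal_genP.
have [C01 nC10] := incC 0%N isT.
have [bs span_ys] := cof.
have [|a [Aa aC1 aC0]] := finite_contraction ringA (primeC 0%N isT) C01 (bs :=
  bs) _ nC10.
  move=> r; have [a [b [Aa pb ->]]] := lin_multi_series complR ysm span_ys r.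
  by exists a, b; split=> //; apply/C0.
have a0 : a != 0 by apply: contraNneq aC0 => ->; exact: ideal_0.
have am : a \in m.
  apply: contraT => /(inv_notin_max maxm complR)[b ab].
  by case/negP: (primeC 1%N isT).1; rewrite -ab; exact: ideal_mulr.
have [zs [szs zsm yz]] := series_drops_parameter ysm Aa a0 am.
have [ps1 C1] := noethR (C 1%N).
have {}C1 r : r \in C 1%N <-> gen ps1 r by rewrite C1; exact: ideal_genP.
have ps1_zs : gen ps1 `<=` gen (zs ++ ps1).
  by apply: gen_subseq => z zps; rewrite mem_cat zps orbT.
apply: (leq_ltn_trans _ szs); apply: (IHn zs ps1 l (C \o succn)) => //.
- exact: leq_trans szs sys.
- by split=> i il; [apply: primeC | apply: incC].
- by move=> r; apply/idP/idP => [/C1/ideal_genP|/ideal_genP/C1].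
- apply: (@cofinite_elim ys).
    move=> y /yz[n' yn]; exists n'; apply: gen_sub yn => z.
    rewrite inE => /predU1P[->|zzs]; first exact/ps1_zs/C1.
    by apply: gen_mem; rewrite mem_cat zzs.
  apply: cofinite_mono cof => y; rewrite mem_cat => /orP[yys|yps].
    by apply: gen_mem; rewrite mem_cat yys.
  apply: (@gen_subseq _ (zs ++ ps1)).
    by move=> z zzs; rewrite mem_cat zzs orbT.
  by apply/ps1_zs/C1/C01/C0/gen_mem.
Qed.

Lemma krull_dim_le zs d : has_krull_dim R d ->
  (forall z, z \in zs -> z \in m) -> cofinite zs -> (d <= size zs)%N.
Proof.
move=> [[C chainC] _] zsm cof; have [ps psC] := noethR (C 0%N).
apply: (chain_length_le zsm chainC psC); apply: cofinite_mono cof => z zzs.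
by apply: gen_mem; rewrite mem_cat zzs.
Qed.

(** Analytic independence in a form that lets constant terms be compared: if b + y s = 0 with b a
    series in the later variables, then b = 0 and s = 0. *)
Fixpoint independent_vars ys : Prop :=
  if ys is y :: ys' then
    [/\ y != 0, forall b s, multi_series K ys' b -> b = y * s -> b = 0
      & independent_vars ys']
  else True.

Lemma independent_vars_neq0 ys y : independent_vars ys -> y \in ys -> y != 0.
Proof.
elim: ys => //= z ys IHys [z0 _ indep]; rewrite inE => /predU1P[-> //|].
exact: IHys.
Qed.

(** If a nonzero series b in the variables after y were a multiple of y, these variables would be
    nilpotent modulo y and fewer elements [zs]; then fewer than dim R elements of m would have
    finite colength, against [krull_dim_le]. If y = 0, it could simply be dropped. *)
Lemma parameters_independent xs : has_krull_dim R (size xs) ->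
  (forall x, x \in xs -> x \in m) -> cofinite xs -> independent_vars xs.
Proof.
move=> dimR xsm cof.
have min_xs zs : cofinite zs -> (forall z, z \in zs -> z \in m) ->
    (size xs <= size zs)%N by move=> cofz zsm; exact: krull_dim_le.
suff H pre ys : xs = pre ++ ys -> independent_vars ys by exact: (H [::]).
elim: ys pre => //= y ys IHys pre xsE; split; last first.
- by apply: (IHys (rcons pre y)); rewrite cat_rcons.
- move=> b s Ab bE; apply/eqP; apply: contraT => b0.
  have ym : y \in m by apply: xsm; rewrite xsE mem_cat mem_head orbT.
  have ysm z : z \in ys -> z \in m.
    by move=> zys; apply: xsm; rewrite xsE mem_cat inE zys !orbT.
  have bm : b \in m by rewrite bE; exact: ideal_mulr.
  have [zs [szs zsm yz]] := series_drops_parameter ysm Ab b0 bm.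
  suff /min_xs min_zs : cofinite (pre ++ y :: zs).
    suff : (size xs <= size (pre ++ y :: zs))%N.
      by rewrite xsE !size_cat /= leq_add2l ltnS leqNgt szs.
    apply: min_zs => z; rewrite mem_cat inE => /or3P[zpre|/eqP-> //|/zsm //].
    by apply: xsm; rewrite xsE mem_cat zpre.
  apply: (@cofinite_elim ys).
    move=> z /yz[n zn]; exists n; apply: gen_sub zn => t.
    rewrite inE => /predU1P[->|tzs].
      by rewrite bE; apply/genMr/gen_mem; rewrite mem_cat mem_head orbT.
    by apply: gen_mem; rewrite mem_cat inE tzs !orbT.
  apply: cofinite_mono cof => z; rewrite xsE => zxs; apply: gen_mem.
  by move: zxs; rewrite !mem_cat !inE => /or3P[]->; rewrite ?orbT.
- apply/eqP => y0; suff /min_xs min_ys : cofinite (pre ++ ys).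
    suff : (size xs <= size (pre ++ ys))%N.
      by rewrite xsE !size_cat /= leq_add2l ltnn.
    apply: min_ys => z; rewrite mem_cat => /orP[] zin; apply: xsm;
      by rewrite xsE mem_cat ?inE zin ?orbT.
  apply: cofinite_mono cof => z; rewrite xsE mem_cat inE y0.
  case/or3P=> [zin|/eqP->|zin]; [|exact: gen0|];
    by apply: gen_mem; rewrite mem_cat zin ?orbT.
Qed.

(** * Colon ideals of powers of independent variables *)

Lemma lin_series_step (B : set R) y zs w : lin (series B y) zs w ->
  exists w0 w1, [/\ lin B zs w0, lin (series B y) zs w1 & w = w0 + y * w1].
Proof.
move=> [c Bc ->].
have /choice[st stP] i : exists u : R * R,
    [/\ B u.1, series B y u.2 & c i = u.1 + y * u.2].
  by have [b [s [Bb ys cE]]] := series_step (Bc i); exists (b, s).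
exists (\sum_(i < size zs) (st i).1 * zs`_i), (\sum_(i < size zs) (st i).2 *
  zs`_i).
split.
- by exists (fun i => (st i).1) => // i; case: (stP i).
- by exists (fun i => (st i).2) => // i; case: (stP i).
- rewrite mulr_sumr -big_split; apply: eq_bigr => i _ /=.
  by case: (stP i) => _ _ ->; ring.
Qed.

Lemma lin_sub_subring (A : set R) zs w : subring A ->
  (forall z, z \in zs -> A z) -> lin A zs w -> A w.
Proof.
move=> ringA zsA [c Ac ->]; apply: subring_sum => // i _; apply: subringM => //.
by apply: zsA; rewrite mem_nth.
Qed.

(** Since t involves only the later variables, constant terms in x can be compared: the induction on
    [xs] treats the constant term, and the rest is divided by x. *)
Lemma series_colon xs ys t n a : independent_vars (xs ++ ys) ->
  multi_series K ys t -> t != 0 -> multi_series K (xs ++ ys) a ->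
  lin (multi_series K (xs ++ ys)) [seq x ^+ n | x <- xs] (a * t) ->
  lin (multi_series K (xs ++ ys)) [seq x ^+ n | x <- xs] a.
Proof.
move=> + At t0; elim: xs a => [|x xs IHxs] a.
  move=> _ Aa; have A0 := subring0 (multi_series_subring ys ringK).
  move=> /(lin_nil _ A0)/eqP; rewrite mulf_eq0 (negPf t0) orbF => /eqP->.
  exact/lin_nil.
have ringA := multi_series_subring (xs ++ ys) ringK.
have At' : multi_series K (xs ++ ys) t.
  elim: (xs) => //= z zs IHzs.
  by apply: sub_series => //; exact: (subring0 (multi_series_subring _ ringK)).
cbn -[GRing.exp]; move: ringA At' IHxs.
set A := multi_series K (xs ++ ys); set Z := map _ xs => ringA At' IHxs.
move=> [x0 Ax ind]; have ringAx := series_subring x ringA.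
have ZA z : z \in Z -> A z.
  move=> /mapP[z' z'xs ->]; apply: subringX => //.
  by apply: multi_series_var; rewrite // mem_cat z'xs.
(* The exponent of x is detached from n, so that it can drop by one at each division by x while the
   powers in [Z] stay fixed. *)
suff H j b c w : series A x b -> series A x c -> lin (series A x) Z w ->
    b * t = c * x ^+ j + w ->
    exists c' w', [/\ series A x c', lin (series A x) Z w' & b = c' * x ^+ j +
      w'].
  move=> Aa /lin_cons[c [w [Ac Zw E]]].
  by have [c' [w' [Ac' Zw' ->]]] := H _ _ _ _ Aa Ac Zw E; apply/lin_cons;
    exists c', w'.
elim: j b c w => [|j IHj] b c w Ab Ac Zw E.
  exists b, 0; split=> //; last by rewrite expr0; ring.
  by apply: lin0; exact: subring0.
have [b0 [s [Ab0 As bE]]] := series_step Ab.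
have [w0 [w1 [Zw0 Zw1 wE]]] := lin_series_step Zw.
(* The left side lies in [A] and is a multiple of x, so independence makes it zero. *)
have E0 : b0 * t - w0 = x * (c * x ^+ j + w1 - s * t).
  have -> : b0 * t - w0 = b * t - x * s * t - w0 by rewrite bE; ring.
  by rewrite E wE exprS; ring.
have b0w0 : b0 * t - w0 = 0.
  apply: Ax E0; apply: subringB => //; first exact: subringM.
  exact: lin_sub_subring Zw0.
have Zb0 : lin A Z b0.
  by apply: IHxs => //; move/eqP: b0w0; rewrite subr_eq0 => /eqP->.
have sE : s * t = c * x ^+ j + w1.
  move: E0; rewrite b0w0 => /esym/eqP; rewrite mulf_eq0 (negPf x0) subr_eq0 /=.
  by move=> /eqP.
have [c' [w' [Ac' Zw' sE']]] := IHj _ _ _ As Ac Zw1 sE.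
exists c', (b0 + x * w'); split=> //.
  apply: linD; [exact: subringD | | ].
    by apply: sub_lin Zb0; apply: sub_series; exact: subring0.
  apply: linZ Zw' => r; apply: subringM => //; exact: series_var.
by rewrite bE sE' exprS; ring.
Qed.

Fixpoint free_over (A : set R) bs : Prop :=
  if bs is b :: bs' then
    (forall a s, A a -> lin A bs' s -> a * b + s = 0 -> a = 0) /\ free_over A
      bs'
  else True.

(** The list [ls] is picked greedily from [bs]. An element b that depends on [ls] satisfies a b + s
    = 0 with a nonzero and s in their span, and c acquires the factor a. *)
Lemma free_submodule (A : set R) bs : subring A -> exists ls c,
  [/\ free_over A ls, A c, c != 0 & forall r, lin A bs r -> lin A ls (c * r)].
Proof.
move=> ringA; have A0 := subring0 ringA; elim: bs => [|b bs [ls [c [freel Ac c0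
  cl]]]].
  exists [::], 1; split=> //; [exact: subring1 | exact: oner_neq0 |].
  by move=> r; rewrite mul1r.
have [indep|] := pselect (forall a s, A a -> lin A ls s -> a * b + s = 0 -> a =
  0).
  exists (b :: ls), c; split=> // r /lin_cons[a [s [Aa bs_s ->]]].
  apply/lin_cons; exists (c * a), (c * s); split; first exact: subringM.
    exact: cl.
  by ring.
move=> /existsNP[a /existsNP[s /not_implyP[Aa /not_implyP[ls_s
  /not_implyP[E]]]]].
move=> /eqP a0; exists ls, (a * c); split=> //; first exact: subringM.
  by rewrite mulf_neq0.
move=> r /lin_cons[a' [s' [Aa' bs_s' ->]]].
have -> : a * c * (a' * b + s') = (- (c * a')) * s + a * (c * s').
  have -> : s = - (a * b) by apply/eqP; rewrite eq_sym -subr_eq0 -oppr_eq0 opprB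
    opprK addrC E.
  by ring.
apply: linD; first exact: subringD.
  by apply: linZ ls_s => x; apply: subringM => //; apply: subringN => //;
    exact: subringM.
by apply: linZ (cl _ bs_s') => x; apply: subringM.
Qed.

Lemma lin_lin_cons (A : set R) l ls zs w : A 0 -> lin (lin A (l :: ls)) zs w ->
  exists a s, [/\ lin A zs a, lin (lin A ls) zs s & w = a * l + s].
Proof.
move=> A0 [c Ac ->].
have /choice[st stP] i : exists u : R * R,
    [/\ A u.1, lin A ls u.2 & c i = u.1 * l + u.2].
  by have /lin_cons[a [s [Aa Ls cE]]] := Ac i; exists (a, s).
exists (\sum_(i < size zs) (st i).1 * zs`_i), (\sum_(i < size zs) (st i).2 *
  zs`_i).
split.
- by exists (fun i => (st i).1) => // i; case: (stP i).
- by exists (fun i => (st i).2) => // i; case: (stP i).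
- rewrite mulr_suml -big_split; apply: eq_bigr => i _ /=.
  by case: (stP i) => _ _ ->; ring.
Qed.

(** Comparing coordinates on the independent list [ls] reduces the colon property to the ring
    [A]. *)
Lemma free_colon (A : set R) zs t : subring A -> A t -> (forall z, z \in zs -> A
  z) ->
  (forall a, A a -> lin A zs (a * t) -> lin A zs a) ->
  forall ls v, free_over A ls -> lin A ls v -> lin (lin A ls) zs (v * t) -> gen
    zs v.
Proof.
move=> ringA At Azs colonA; have A0 := subring0 ringA.
elim=> [|l ls IHls] v /=; first by move=> _ /(lin_nil _ A0)-> _; exact: gen0.
move=> [indep freel] /lin_cons[a [v' [Aa lv' ->]]].
move=> /(lin_lin_cons A0)[a' [s [za' zs_s E]]].
have Aa' : A a' by exact: lin_sub_subring za'.
have ls_s : lin A ls s.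
  case: zs_s => c lc ->; elim/big_ind: _ => [|x y|i _]; first exact: lin0.
    by apply: linD; exact: subringD.
  rewrite mulrC; apply: linZ (lc i) => x Ax; apply: subringM => //.
  by apply: Azs; rewrite mem_nth.
have E0 : (a * t - a') * l + (t * v' - s) = 0.
  have -> : (a * t - a') * l + (t * v' - s) = (a * l + v') * t - (a' * l + s) by
    ring.
  by rewrite E subrr.
have at_a' : a * t - a' = 0.
  apply: indep E0; first by apply: subringB => //; exact: subringM.
  apply: linD; [exact: subringD | by apply: linZ lv' => x; exact: subringM |].
  by rewrite -mulN1r; apply: linZ ls_s => x Ax; rewrite mulN1r; exact: subringN.
have v'E : v' * t = s.
  by apply/eqP; rewrite -subr_eq0 mulrC; move: E0;
    rewrite at_a' mul0r add0r => /eqP.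
apply: genD; last by apply: IHls; rewrite ?v'E.
apply: genMr; apply: (@sub_lin _ A) => //; apply: colonA => //.
by move/eqP: at_a'; rewrite subr_eq0 => /eqP->.
Qed.

Lemma uniform_colon_of_coefficient_field xs z ys :
  has_krull_dim R (size (xs ++ z :: ys)) ->
  (forall a, a \in m <-> power_in (xs ++ z :: ys) a) ->
  exists2 c, c != 0 & forall n r,
    gen [seq x ^+ n | x <- xs] (r * z ^+ n) -> gen [seq x ^+ n | x <- xs] (c *
      r).
Proof.
move=> dimR m_xs; set all := xs ++ z :: ys.
have allm x : x \in all -> x \in m.
  by move=> xall; apply/m_xs; exists 1%N; rewrite expr1; exact: gen_mem.
have cof : cofinite all by apply: cofinite_parameters => a /m_xs.
have indep := parameters_independent dimR allm cof.
have ringA := multi_series_subring all ringK.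
(* No generators are left over, so R itself is finite over the values of series in all the
   parameters. *)
have [bs span_bs] := cof; rewrite -[all]cats0 in span_bs.
have {}span_bs := lin_multi_series complR allm span_bs.
have [ls [c [freel Ac c0 cl]]] := free_submodule bs ringA.
have cR r : lin (multi_series K all) ls (c * r).
  by apply: cl; have [a [b [la /(lin_nil _ I)-> ->]]] := span_bs r;
    rewrite addr0.
exists c => // n r zr.
have Avar x : x \in all -> multi_series K all x by move=> xall;
  exact: multi_series_var.
have z_all : z \in all by rewrite mem_cat mem_head orbT.
apply: (free_colon (A := multi_series K all) (t := z ^+ n) _ _ _ _ freel (cR r))
  => //.
- by apply: subringX => //; exact: Avar.
- move=> _ /mapP[x xxs ->]; apply: subringX => //; apply: Avar.
  by rewrite mem_cat xxs.
(* z comes after [xs], so z^n is a series in the later variables [z :: ys]. *)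
- move=> a Aa; apply: series_colon => //.
    apply: subringX; first exact: multi_series_subring.
    by apply: multi_series_var; rewrite ?mem_head.
  by apply: expf_neq0; exact: independent_vars_neq0 indep z_all.
(* Multiplication by c carries the coefficients of the relation, arbitrary elements of R, into the
   free module. *)
- by rewrite -mulrA; apply: linZ zr => b _; exact: cR.
Qed.

End OverCoefficientField.

(** * Existence of a coefficient field *)

Section CoefficientField.
Variables (p : nat) (R : comNzRingType) (charRp : p \in [pchar R]).
Variables (m : ideal R) (maxm : maximal_ideal m).
Implicit Types (S E A B : set R) (r s : R).

Let p_gt1 : (1 < p)%N := prime_gt1 (pcharf_prime charRp).

Lemma maximal_ideal_expr r n : r ^+ n \in m -> r \in m.
Proof.
have [L [pi [_ piE]]] := residue_field maxm.
by rewrite -!piE rmorphXn expf_eq0 => /andP[].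
Qed.

(** For n > 0, the preimages in R of the coefficient fields of R/m^n. *)
Definition partial_lift n S : Prop :=
  [/\ subring S, (forall r, r \in ideal_pow m n -> S r),
      (forall r, S r -> r \in m -> r \in ideal_pow m n)
    & forall r, exists2 s, S s & r - s \in m].

(** * Lifting the residue field from m^n to m^(n+1) *)

Section Step.
Variables (n : nat) (S : set R) (liftS : partial_lift n S).

Let ringS : subring S. Proof. by case: liftS. Qed.
Let subS r : r \in ideal_pow m n -> S r. Proof. by case: liftS => _ + _ _;
  apply. Qed.
Let capS r : S r -> r \in m -> r \in ideal_pow m n.
Proof. by case: liftS => _ _ + _; apply. Qed.
Let genS r : exists2 s, S s & r - s \in m. Proof. by case: liftS => _ _ _;
  apply. Qed.

(** All that is asked of the next lift except surjectivity onto the residue field, which will follow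
    from maximality; the p-th powers make the residue extension purely inseparable. *)
Let admissible E : Prop :=
  [/\ subring E, E `<=` S, (forall r, r \in ideal_pow m n.+1 -> E r),
      (forall r, E r -> r \in m -> r \in ideal_pow m n.+1)
    & forall s, S s -> E (s ^+ p)].

(** The smallest admissible subring. *)
Let E0 : set R := [set r | exists s t, [/\ S s, t \in ideal_pow m n.+1 & r = s
  ^+ p + t]].

Let frobB r s : (r - s) ^+ p = r ^+ p - s ^+ p.
Proof. by rewrite -!(pFrobenius_autE charRp) rmorphB. Qed.

Let admissible_E0 : admissible E0.
Proof.
have pS s : S s -> E0 (s ^+ p).
  by move=> Ss; exists s, 0; split; rewrite ?ideal_0 ?addr0.
split=> //.
- split; first by rewrite -(expr1n _ p); apply: pS; exact: subring1.
    move=> _ _ [s [t [Ss tm ->]]] [s' [t' [Ss' tm' ->]]].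
    exists (s - s'), (t - t'); split; [exact: subringB | exact: ideal_sub |].
    by rewrite frobB; ring.
  move=> _ _ [s [t [Ss tm ->]]] [s' [t' [Ss' tm' ->]]].
  exists (s * s'), (s ^+ p * t' + t * (s' ^+ p + t')); split;
    first exact: subringM.
    by apply: ideal_add; [exact: ideal_mull | exact: ideal_mulr].
  by rewrite exprMn; ring.
- move=> _ [s [t [Ss tm ->]]]; apply: subringD => //; first exact: subringX.
  exact/subS/ideal_pow_decr.
- move=> r rm; exists 0, r; split=> //; first exact: subring0.
  by rewrite expr0n gtn_eqF ?add0r // ltnW.
- move=> _ [s [t [Ss tm ->]]] spt_m; apply: ideal_add => //.
  (* If s^p + t is in m, then so is s, hence s is in m^n; as p >= 2, s^p is a multiple of s times s,
     which lies in m^(n+1). *)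
  have sm : s \in m.
    apply: (@maximal_ideal_expr _ p); rewrite -(addrK t (s ^+ p));
      apply: ideal_sub => //.
    apply: ideal_pow1; exact: ideal_pow_anti tm.
  have -> : s ^+ p = s * (s * s ^+ p.-2) by rewrite -!exprS;
    case: p p_gt1 => [|[]].
  by apply: mem_ideal_powS => //; apply: ideal_mulr; exact: capS.
Qed.

Let maximal_admissible : exists2 E, admissible E &
  forall B, admissible B -> E `<=` B -> B `<=` E.
Proof.
(* Joining [E0] to every set makes the union of the empty chain admissible too. *)
pose P (A : set R) : Prop := admissible (A `|` E0).
have [F FP totF|A [PA maxA]] := @Zorn_bigcup _ P; last first.
  exists (A `|` E0) => // B admB AB b Bb; apply: contrapT => nAb.
  have E0B : E0 `<=` B by move=> r E0r; apply: AB; right.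
  apply: (maxA B); last by rewrite /P setUidl.
  split=> [r Ar|BA]; first by apply: AB; left.
  by apply: nAb; left; exact: BA.
have upper r s : (\bigcup_(X in F) X `|` E0) r -> (\bigcup_(X in F) X `|` E0) s
  ->
    exists A, [/\ admissible A, A `<=` \bigcup_(X in F) X `|` E0, A r & A s].
  have inF X : F X -> X `|` E0 `<=` \bigcup_(X in F) X `|` E0.
    by move=> FX t [Xt|]; [left; exists X | right].
  case=> [[X FX Xr]|E0r] [[Y FY Ys]|E0s].
  - have [XY|YX] := totF X Y FX FY.
      by exists (Y `|` E0); split; [exact: FP|exact: inF|left; exact: XY|left].
    by exists (X `|` E0); split; [exact: FP|exact: inF|left|left; exact: YX].
  - by exists (X `|` E0); split; [exact: FP|exact: inF|left|right].
  - by exists (Y `|` E0); split; [exact: FP|exact: inF|right|left].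
  - by exists E0; split=> // t; right.
have [ring0 sub0 pow0 cap0 frob0] := admissible_E0.
split.
- split; first by right; exact: subring1.
    move=> r s /upper + /[dup] => /[apply] -[A [[ringA _ _ _ _] AF Ar As]] _.
    by apply: AF; exact: subringB.
  move=> r s /upper + /[dup] => /[apply] -[A [[ringA _ _ _ _] AF Ar As]] _.
  by apply: AF; exact: subringM.
- by move=> r /[dup] /upper + => /[apply] -[A [[_ AS _ _ _] _ Ar _]]; exact: AS.
- by move=> r /pow0; right.
- by move=> r /[dup] /upper + => /[apply] -[A [[_ _ _ capA _] _ Ar _]];
  exact: capA.
- by move=> s /frob0; right.
Qed.

(** If a maximal admissible E missed a residue class, that of l in S, then E[l] would be admissible
    and strictly larger. *)
Lemma partial_lift_step : exists2 S', partial_lift n.+1 S' & S' `<=` S.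
Proof.
have [E admE maxE] := maximal_admissible.
have [ringE ES powE capE frobE] := admE.
exists E => //; split=> // r0; apply: contrapT => nE.
have [l Sl lr0] := genS r0.
have {nE} nEl e : E e -> l - e \notin m.
  move=> Ee; apply/negP => lem; apply: nE; exists e => //.
  have -> : r0 - e = (r0 - l) + (l - e) by ring.
  exact: ideal_add.
have [L [pi [pi_surj piE]]] := residue_field maxm.
pose F : set L := [set x | exists2 e, E e & x = pi e].
have charLp : p \in [pchar L] := rmorph_pchar pi charRp.
have F1 : F 1 by exists 1; [exact: subring1 | rewrite rmorph1].
have FB x y : F x -> F y -> F (x - y).
  move=> [a Ea ->] [b Eb ->]; exists (a - b);
    [exact: subringB | by rewrite rmorphB].
have FM x y : F x -> F y -> F (x * y).
  move=> [a Ea ->] [b Eb ->]; exists (a * b);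
    [exact: subringM | by rewrite rmorphM].
(* x^-1 = x^(p-1) (x^-1)^p, and the last factor is the residue of the p-th power of an element of S,
   which lies in E. *)
have FV x : F x -> F x^-1.
  have [-> |x0 Fx] := eqVneq x 0; first by rewrite invr0.
  have [r xr] := pi_surj x^-1; have [s Ss rsm] := genS r.
  have -> : x^-1 = x ^+ p.-1 * pi (s ^+ p).
    have -> : pi (s ^+ p) = x^-1 ^+ p.
      rewrite rmorphXn -xr; congr (_ ^+ _); apply/esym/eqP.
      by rewrite -subr_eq0 -rmorphB piE.
    have -> : p = p.-1.+1 by rewrite prednK // ltnW.
    by rewrite /= exprS exprVn mulrCA mulfV ?mulr1 // expf_neq0.
  apply: (FM); last by exists (s ^+ p) => //; exact: frobE.
  by elim: p.-1 => [|k IHk]; rewrite ?expr0 // exprS; exact: FM.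
have nFl : ~ F (pi l).
  by move=> [e Ee /eqP]; rewrite -subr_eq0 -rmorphB piE; exact/negP/nEl.
have Flp : F (pi l ^+ p) by exists (l ^+ p); [exact: frobE | rewrite rmorphXn].
(* Reduction modulo X^p - l^p, whose coefficients lie in E, brings the degree below p without
   changing the value at l. *)
have reduce (q : {poly R}) : (forall i, E q`_i) ->
    exists q' : {poly R}, [/\ forall i, E q'`_i, (size q' <= p)%N & q'.[l] =
      q.[l]].
  have E0' := subring0 ringE.
  elim/poly_ind: q => [|q c IHq] Eq.
    by exists 0; split=> [i||]; rewrite ?coef0 ?size_poly0.
  have [i|q' [Eq' sq' rq']] := IHq.
    by have := Eq i.+1; rewrite coefD coefMX coefC /= addr0.
  pose a := q'`_p.-1; pose h := q' * 'X + (c + a * l ^+ p)%:P - a *: 'X^p.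
  have hE i : h`_i = (if i == 0%N then 0 else q'`_i.-1) +
      (if i == 0%N then c + a * l ^+ p else 0) - a * (i == p)%:R.
    by rewrite coefB coefD coefMX coefC coefZ coefXn.
  exists h; split.
  - move=> i; rewrite hE; apply: subringB => //.
      apply: subringD => //; first by case: ifP.
      case: ifP => // _; apply: subringD => //.
        by have := Eq 0%N; rewrite coefD coefMX coefC /= add0r.
      by apply: subringM => //; [exact: Eq' | exact: frobE].
    apply: subringM => //; first exact: Eq'.
    by case: (i == p) => //; exact: subring1.
  - apply/leq_sizeP => i pi_; rewrite hE gtn_eqF ?addr0;
    last by apply: leq_trans pi_; exact: ltnW.
    have [->|ip] := eqVneq i p; first by rewrite mulr1 subrr.
    rewrite mulr0 subr0 nth_default //; apply: leq_trans sq' _.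
    have : (p < i)%N by rewrite ltn_neqAle eq_sym ip.
    by case: (i).
  - by rewrite /h !hornerE /= rq'; ring.
pose B : set R := [set r | exists2 q : {poly R}, forall i, E q`_i & r = q.[l]].
have EB : E `<=` B.
  move=> e Ee; exists e%:P; last by rewrite hornerC.
  by move=> i; rewrite coefC; case: ifP => // _; exact: subring0.
have Bl : B l.
  exists 'X; last by rewrite hornerX.
  by move=> i; rewrite coefX; case: (i == 1%N);
    [exact: subring1 | exact: subring0].
have polyE := poly_subring ringE.
suff /maxE/(_ EB)/(_ l Bl)/nEl : admissible B by rewrite subrr ideal_0.
split.
- split; first by apply: EB; exact: subring1.
    move=> _ _ [q Eq ->] [q' Eq' ->]; exists (q - q'); last by rewrite !hornerE.
    exact: (subringB polyE).
  move=> _ _ [q Eq ->] [q' Eq' ->]; exists (q * q'); last by rewrite !hornerE.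
  exact: (subringM polyE).
- move=> _ [q Eq ->]; rewrite horner_coef; apply: subring_sum => // i _.
  by apply: subringM => //; [exact: ES | exact: subringX].
- by move=> r /powE; exact: EB.
(* The residue polynomial has degree below p and vanishes at the residue of l, so it is zero; the
   coefficients of q' then lie in E and in m, hence in m^(n+1). *)
- move=> _ [q /reduce[q' [Eq' sq' <-]] ->] q'm.
  have q'0 : map_poly pi q' = 0.
    apply: (purely_inseparable_free charLp F1 FB FM FV nFl Flp).
    - by move=> i; rewrite coef_map; exists q'`_i.
    - exact: leq_trans (size_poly _ _) sq'.
    - by rewrite horner_map /=; apply/eqP; rewrite piE.
  rewrite horner_coef; elim/big_ind: _ => [|a b|i _];
    [exact: ideal_0|exact: ideal_add|].
  apply: ideal_mulr; apply: capE => //; rewrite -piE -coef_map q'0 coef0 //.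
- by move=> s /frobE; exact: EB.
Qed.

End Step.

Hypothesis complR : adic_complete m.

(** For surjectivity, r is corrected successively to s n in [S n] within its residue class.
    Consecutive terms differ by elements of m in [S n], hence of m^(n+1), so they converge; the
    limit lies in every [S n], as [S n] contains m^(n+1). *)
Lemma coefficient_field : exists K : set R,
  [/\ subring K, forall a, K a -> a \in m -> a = 0
    & forall r, exists2 k, K k & r - k \in m].
Proof.
have lift1 : partial_lift 1 setT.
  split=> // [r _ rm|r]; last by exists r; rewrite ?subrr ?ideal_0.
  by rewrite -[r]mulr1; apply: mem_ideal_powS => //; exact: mem_ideal_pow0.
have /choice[next nextP] (u : nat * set R) : exists S',
    partial_lift u.1.+1 u.2 -> partial_lift u.1.+2 S' /\ S' `<=` u.2.
  have [lift|nlift] := pselect (partial_lift u.1.+1 u.2); last by exists setT.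
  by have [S' liftS' S'S] := partial_lift_step lift; exists S'.
(* The index is shifted: [S n] lifts the residue field modulo m^(n+1), starting from the whole ring
   modulo m. *)
pose S := fix S n := if n is k.+1 then next (k, S k) else setT.
have liftS n : partial_lift n.+1 (S n).
  by elim: n => //= n IHn; have [] := nextP (n, S n) IHn.
have decS n : S n.+1 `<=` S n by have [] := nextP (n, S n) (liftS n).
exists [set r | forall n, S n r]; split.
- split=> [n|a b Sa Sb n|a b Sa Sb n]; have [ringS _ _ _] := liftS n.
  + exact: subring1.
  + exact: subringB.
  + exact: subringM.
- move=> a Sa am; apply: (adic_separated complR) => -[|n];
  first exact: mem_ideal_pow0.
  by have [_ _ + _] := liftS n; apply.
move=> r.
have /choice[nx nxP] (u : nat * R) : exists s, S u.1.+1 s /\ u.2 - s \in m.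
  by have [_ _ _ /(_ u.2)[s]] := liftS u.1.+1; exists s.
pose s := fix s n := if n is k.+1 then nx (k, s k) else r.
have Ss n : S n (s n) by case: n => //= n; have [] := nxP (n, s n).
have s_step n : s n - s n.+1 \in ideal_pow m n.+1.
  have [ringS _ capS _] := liftS n; apply: capS;
    last by have [] := nxP (n, s n).
  by apply: subringB => //; exact/decS/Ss.
have s_tail n i : (n <= i)%N -> s n - s i \in ideal_pow m n.+1.
  move=> ni; rewrite -(subnKC ni); elim: (i - n)%N => [|j IHj].
    by rewrite addn0 subrr ideal_0.
  rewrite addnS -(subrK (s (n + j)%N) (s n)) -addrA; apply: ideal_add => //.
  by apply: ideal_pow_anti (s_step _); rewrite ltnS leq_addr.
have [|l [lim_l _]] := complR (a := s).
  move=> n; exists n => i j ni nj.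
  have -> : s i - s j = (s n - s j) - (s n - s i) by ring.
  by apply: ideal_pow_decr; apply: ideal_sub; exact: s_tail.
have l_tail n : s n - l \in ideal_pow m n.+1.
  have [N limN] := lim_l n.+1.
  rewrite -(subrK (s (maxn n N)) (s n)) -addrA; apply: ideal_add.
    by apply: s_tail; exact: leq_maxl.
  by apply: limN; exact: leq_maxr.
exists l => [n|].
  have [ringS powS _ _] := liftS n.
  by rewrite -(subKr (s n) l); apply: subringB => //; exact: powS.
exact/ideal_pow1/(l_tail 0%N).
Qed.

End CoefficientField.

(** * Tight closure *)

Lemma uniform_colon (p : nat) (R : idomainType) (charRp : p \in [pchar R])
  (m : ideal R) (xs ys : seq R) (z : R) :
  local_ring m -> adic_complete m -> system_of_parameters m (xs ++ z :: ys) ->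
  exists2 c, c != 0 & forall n r,
    gen [seq x ^+ n | x <- xs] (r * z ^+ n) -> gen [seq x ^+ n | x <- xs] (c *
      r).
Proof.
move=> [noethR maxm _] complR [dimR m_xs].
have [K [ringK Km KR]] := coefficient_field charRp maxm complR.
apply: (uniform_colon_of_coefficient_field noethR maxm complR ringK Km KR dimR).
by move=> a; rewrite m_xs; split=> -[n an]; exists n; apply/ideal_genP.
Qed.

(** In a domain the zero ideal is the only minimal prime. *)
Lemma minimal_prime_idomain (R : idomainType) (c : R) :
  (forall P : ideal R, minimal_prime P -> c \notin P) <-> c != 0.
Proof.
have [|||Z ZE] := @submod_of R R^o [set 0] => //.
- by move=> a b /= -> ->; rewrite addr0.
- by move=> a b /= ->; rewrite scaler0.
have {}ZE (a : R) : (a \in Z) = (a == 0).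
  by rewrite ZE; apply/asboolP/eqP.
have primeZ : prime_ideal Z.
  by split=> [|a b]; rewrite !ZE ?oner_eq0 // mulf_eq0.
split=> [/(_ Z)|c0 P [_ minP]].
  rewrite ZE; apply; split=> // Q _ _ a; rewrite ZE => /eqP->; exact: ideal_0.
apply: contra c0 => cP; rewrite -ZE; apply: minP cP => //.
by move=> a; rewrite ZE => /eqP->; exact: ideal_0.
Qed.

Lemma mem_cyclic_submod (R : nzRingType) (M : lmodType R) (v w : M) :
  w \in cyclic_submod v -> exists s, w = s *: v.
Proof.
have [|||N NE] := @submod_of R M [set w | exists s, w = s *: v].
- by exists 0; rewrite scale0r.
- by move=> _ _ [s ->] [t ->]; exists (s + t); rewrite scalerDl.
- by move=> a _ [s ->]; exists (a * s); rewrite scalerA.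
move=> wv; apply/asboolP; rewrite -NE; apply: (span_min _ wv) => _ ->.
by rewrite NE; apply/asboolP; exists 1; rewrite scale1r.
Qed.

(** * Images of Rv and Jv under base change *)

Section BaseChangeImages.
Variables (R S : comNzRingType) (phi : {rmorphism R -> S}) (M : lmodType R) (v :
  M).

Lemma tensDl a b : tens phi (a + b) v = tens phi a v + tens phi b v.
Proof. by rewrite tensE scalerDl -!tensE. Qed.

Lemma tensMl a b : tens phi (a * b) v = a *: tens phi b v.
Proof. by rewrite tensE -scalerA -tensE. Qed.

Lemma tens_scale a b : tens phi a (b *: v) = tens phi (a * phi b) v.
Proof. by rewrite tensE tens1Z scalerA -tensE. Qed.

Lemma base_change_cyclic (z : base_change phi (submod_type (cyclic_submod v))) :
  exists r, base_change_map (submod_incl (cyclic_submod v)) z = tens phi r v.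
Proof.
elim/base_change_ind: z => [|r u z [s zs]].
  by exists 0; rewrite linear0 tensE scale0r.
have [t ut] := mem_cyclic_submod (valP u); exists (r * phi t + s).
by rewrite linearD /= zs base_change_map_tens /= ut tens_scale tensDl.
Qed.

(** The element a phi(x) (x) v is the image of a (x) xv, and xv lies in Jv for x in J. *)
Lemma base_change_ideal_mul (J : ideal R) xs r : (forall x, x \in xs -> x \in J)
  ->
  gen [seq phi x | x <- xs] r ->
  exists z : base_change phi (submod_type (ideal_mul J (cyclic_submod v))),
    base_change_map (submod_incl (ideal_mul J (cyclic_submod v))) z
    = tens phi r v.
Proof.
elim: xs r => [|x xs IHxs] r xsJ.
  by move=> /(lin_nil _ I)->; exists 0; rewrite linear0 tensE scale0r.
move=> /lin_cons[a [s [_ xs_s ->]]].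
have [|z zs] := IHxs s _ xs_s; first by move=> y yxs; apply: xsJ;
  rewrite inE yxs orbT.
have xvN : x *: v \in ideal_mul J (cyclic_submod v).
  apply: mem_span; exists x, v; split=> //; first by apply: xsJ;
    rewrite mem_head.
  exact: mem_span.
pose w : submod_type (ideal_mul J (cyclic_submod v)) := Sub (x *: v) xvN.
exists (tens phi a w + z).
by rewrite linearD /= zs base_change_map_tens /= tens_scale tensDl.
Qed.

End BaseChangeImages.

(* Base change of f, followed by S (x) R/J -> S/JS. *)
Lemma base_change_modquot (R S : comNzRingType) (phi : {rmorphism R -> S})
  (xs : seq R) (J : ideal R) (M : lmodType R) (f : {linear M -> modquot J})
  (v u : M) (z : R) (c r : S) :
  J = ideal_gen xs -> f v = modpi J z -> f u = 0 ->
  tens phi c u = tens phi r v -> gen [seq phi x | x <- xs] (r * phi z).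
Proof.
move=> JE fv fu E; pose Jq : ideal S := ideal_gen [seq phi x | x <- xs].
have phiJ a : a \in J -> phi a \in Jq.
  rewrite JE => /ideal_genP[d _ ->]; rewrite rmorph_sum /=; apply/ideal_genP.
  exists (phi \o d) => //; rewrite size_map; apply: eq_bigr => i _.
  by rewrite (nth_map 0) //= rmorphM.
have /choice[rho rhoP] (w : M) : exists a : R, f w = modpi J a.
  by exists (repr (f w : Quotient.quot (submod_zmod J))); rewrite modpi_repr.
(* The lift [rho] of f is only a function, but phi maps J into [Jq], so modulo [Jq] the choice of
   representatives does not matter and g is semilinear. *)
pose g (w : M) : modquot Jq := modpi Jq (phi (rho w)).
have gE w a : f w = modpi J a -> g w = modpi Jq (phi a).
  rewrite rhoP => /modpi_eq waJ; apply/modpi_eq.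
  by have := phiJ _ waJ; rewrite rmorphB.
have g_semilin : semilinear_along phi g.
  split=> [a b|a b].
    rewrite (gE _ (rho a + rho b : R)) ?rmorphD ?modpiD //.
    by rewrite linearD /= !rhoP -modpiD.
  rewrite (gE _ (a * rho b : R)); last by rewrite linearZ /= rhoP -linearZ.
  by rewrite rmorphM /g -linearZ.
have [h [hE _]] := base_change_universal g_semilin.
have := congr1 h E; rewrite (tensE phi c u) (tensE phi r v) !linearZ /= !hE.
rewrite (gE _ _ fv) (gE u 0) ?linear0 // rmorph0 linear0 scaler0 -linearZ /=.
by move=> /esym; rewrite -[0 in RHS](linear0 (modpi Jq)) => /modpi_eq;
  rewrite subr0 => /ideal_genP.
Qed.

Theorem proposition5p6 (p : nat) (R : idomainType) (charRp : p \in [pchar R])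
  (m : ideal R) (locR : local_ring m) (complR : adic_complete m)
  (k : nat) (x : (k.+1).-tuple R) (sopx : partial_system_of_parameters m x)
  (J : ideal R) (defJ : J = ideal_gen (take k x))
  (M : lmodType R) (fgM : finitely_generated M)
  (f : {linear M -> modquot J})
  (surjf : forall y : modquot J, exists u : M, f u = y)
  (v : M) (fv : f v = modpi J (tnth x ord_max)) :
  tight_closure charRp (cyclic_submod v) `&` [set u | f u = 0]
    `<=` tight_closure charRp (ideal_mul J (cyclic_submod v)).
Proof.
move=> u [[c /minimal_prime_idomain c0 [e0 ce]] /= fu].
have [ys sop] := sopx.
have xE : (x : seq R) = rcons (take k x) (tnth x ord_max).
  by rewrite (tnth_nth 0) /= -take_nth ?size_tuple // take_oversize ?size_tuple.
rewrite xE cat_rcons in sop.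
have [c' c'0 colon] := uniform_colon charRp locR complR sop.
(* c' does not depend on the exponent, so one multiplier serves for all large e. *)
exists (c' * c); first by apply/minimal_prime_idomain; rewrite mulf_neq0.
exists e0 => e /ce[z zE].
have [r zr] := base_change_cyclic z.
have cr : tens (iter_frobenius charRp e) c u
    = tens (iter_frobenius charRp e) r v.
  by rewrite -zE -zr.
have : gen [seq iter_frobenius charRp e y | y <- take k x]
    (r * iter_frobenius charRp e (tnth x ord_max)) :=
  base_change_modquot defJ fv fu cr.
have phiE : [seq iter_frobenius charRp e y | y <- take k x]
    = [seq y ^+ (p ^ e) | y <- take k x].
  by apply: eq_map => y; exact: iter_frobeniusE.
(* [colon] with n = p^e puts c' r into the ideal of the Frobenius images of x_1, ..., x_k. *)
rewrite iter_frobeniusE phiE => /colon; rewrite -phiE => c'r.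
have takeJ y : y \in take k x -> y \in J.
  by move=> yx; rewrite defJ; apply/ideal_genP/gen_mem.
have [w wE] := base_change_ideal_mul v takeJ c'r.
by exists w; rewrite tensMl cr -tensMl -wE.
Qed.
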